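(* Let $H$ be a Hilbert space and let $W=\bigoplus_i W_i\subseteq B(H)$ be a countable direct sum of Type I factors, where $P_1,P_2,\ldots\in B(H)$ are projections such that $W_i=P_iB(H)P_i$ for each $i$. If $\alpha$ is a normal $*$-endomorphism of $W$, then there exist a graph $E=(E^0,E^1,r,s)$ and a $*$-representation $\tau:\mathcal{T}_{X(E)}\to B(H)$ such that $\alpha=Ad_\tau$, i.e. $\alpha(w)=\sum_{e\in E^1}\tau(\delta_e)w\tau(\delta_e)^*$ for all $w\in W$.
   Context: The direct sum $W=\bigoplus_i W_i$ is the (internal) von Neumann algebra direct sum inside $B(H)$, the $P_i$ being mutually orthogonal. $*$-endomorphisms are not assumed unital. The sum defining $Ad_\tau$ converges in the strong operator topology. A graph is a tuple $E=(E^0,E^1,r,s)$ with vertex set $E^0$, edge set $E^1$ and range and source maps $r,s:E^1\to E^0$; $E^0$ and $E^1$ are assumed at most countable, and $E^0$ is regarded as a discrete space. A $C^*$-correspondence over a $C^*$-algebra $A$ is a right Hilbert $A$-module $X$ together with a $*$-homomorphism $\phi:A\to L(X)$, where $L(X)$ is the algebra of adjointable $A$-module maps on $X$. The graph correspondence $X(E)$ is the set of functions $x:E^1\to\mathbb{C}$ for which $\hat{x}(v):=\sum_{e\in s^{-1}(v)}|x(e)|^2$ defines a function $\hat{x}\in C_0(E^0)$. It is a $C^*$-correspondence over $C_0(E^0)$ via $(x\cdot a)(e)=x(e)a(s(e))$, $(\phi(a)x)(e)=a(r(e))x(e)$, $\langle x,y\rangle(v)=\sum_{e\in s^{-1}(v)}\overline{x(e)}y(e)$.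 The functions $\delta_e\in X(E)$ ($e\in E^1$) and $\delta_v\in C_0(E^0)$ ($v\in E^0$) are the point masses. A Toeplitz representation of a $C^*$-correspondence $X$ over $A$ in a $C^*$-algebra $B$ is a pair $(\sigma,\pi)$ of a linear map $\sigma:X\to B$ and a $*$-homomorphism $\pi:A\to B$ with $\sigma(x\cdot a)=\sigma(x)\pi(a)$, $\sigma(\phi(a)x)=\pi(a)\sigma(x)$ and $\pi(\langle x,y\rangle)=\sigma(x)^*\sigma(y)$ for all $x,y\in X$, $a\in A$. The Toeplitz algebra $\mathcal{T}_X$ is the universal $C^*$-algebra carrying a Toeplitz representation $(\sigma_u,\pi_u)$ of $X$: for every Toeplitz representation $(\sigma,\pi)$ of $X$ in a $C^*$-algebra $B$ there is a unique $*$-homomorphism $\rho:\mathcal{T}_X\to B$ with $\sigma=\rho\circ\sigma_u$ and $\pi=\rho\circ\pi_u$. Elements of $X(E)$ and $C_0(E^0)$ are identified with their images in $\mathcal{T}_{X(E)}$ under $\sigma_u$ and $\pi_u$.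
   Formalization: The edge set E^1 is asserted to be at most countable only when H is separable; for nonseparable H it may be uncountable, since α(w)=w⊗1 on B(H) with H⊗H≅H nonseparable cannot be a countable sum of τ(δ_e)wτ(δ_e)*. *)

(* Defs.v *)
From HB Require Import structures.
From mathcomp Require Import all_boot all_order all_algebra finmap.
From mathcomp Require Import complex.
From mathcomp Require Import boolp classical_sets functions cardinality reals.
From mathcomp Require Import topology normedtype.
From mathcomp.analysis.showcase Require Import summability.

Set Implicit Arguments.
Unset Strict Implicit.
Unset Printing Implicit Defensive.

Import Order.TTheory GRing.Theory Num.Theory.
Import numFieldNormedType.Exports.

Local Open Scope classical_set_scope.
Local Open Scope ring_scope.

(** Sums over arbitrary index sets are unordered: they are limits of finite
    partial sums along the filter [totally] of finite subsets. *)
Definition has_sum (K : numFieldType) (V : normedModType K) (I : choiceType)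
    (f : I -> V) (l : V) : Prop :=
  partial_sum f A @[A --> totally] --> l.

Definition separable (T : topologicalType) : Prop :=
  exists2 D : set T, countable D & dense D.

(** Hilbert spaces. The inner product follows the library's convention for
    [{dot _ for _}]: linear in the first variable. *)
HB.mixin Record isHilbert (R : realType) H of CompleteNormedModule R[i] H := {
  inner : {dot H for @Num.conj R[i]} ;
  inner_norm : forall x : H, inner x x = `|x| ^+ 2
}.

#[short(type="hilbertType")]
HB.structure Definition Hilbert (R : realType) :=
  { H of CompleteNormedModule R[i] H & isHilbert R H }.

(** C*-algebras, not assumed unital. *)
HB.mixin Record isCStarAlgebra (R : realType) A
    of CompleteNormedModule R[i] A := {
  cmul : A -> A -> A ;
  cstar : A -> A ;
  cmulA : associative cmul ;
  cmul_linearl : forall b : A, linear (cmul^~ b) ;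
  cmul_linearr : forall a : A, linear (cmul a) ;
  cmul_norm : forall a b : A, `|cmul a b| <= `|a| * `|b| ;
  cstarK : involutive cstar ;
  cstarP : forall (k : R[i]) (a b : A),
    cstar (k *: a + b) = k^* *: cstar a + cstar b ;
  cstarM : forall a b : A, cstar (cmul a b) = cmul (cstar b) (cstar a) ;
  cstar_norm : forall a : A, `|cmul (cstar a) a| = `|a| ^+ 2
}.

#[short(type="cstarType")]
HB.structure Definition CStarAlgebra (R : realType) :=
  { A of CompleteNormedModule R[i] A & isCStarAlgebra R A }.

Definition star_hom (R : realType) (A B : cstarType R) (f : A -> B) : Prop :=
  [/\ linear f,
      forall a b, f (cmul a b) = cmul (f a) (f b)
    & forall a, f (cstar a) = cstar (f a)].

(** ** Operators on a Hilbert space *)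

Section Operators.
Variables (R : realType) (H : hilbertType R).
Implicit Types (S T : H -> H) (M : set (H -> H)).

(** B(H); continuity of a linear map is boundedness. *)
Definition BH : set (H -> H) := [set T | linear T /\ continuous T].

(** For [T] in B(H) such a [z] exists (Riesz) and is unique. *)
Definition adj T : H -> H :=
  fun y => xget 0 [set z | forall x, inner (T x) y = inner x z].

Definition projection T : Prop := [/\ BH T, T \o T = T & adj T = T].

(** The order on R[i] makes this include that each <Tx - Sx, x> is real. *)
Definition op_le S T : Prop := forall x, 0 <= inner (T x - S x) x.

Definition selfadjoint T : Prop := BH T /\ adj T = T.

(** Least upper bound in the self-adjoint part of [M]. *)
Definition is_op_lub M (D : set (H -> H)) T : Prop :=
  [/\ M T, selfadjoint T, (forall S, D S -> op_le S T)
    & forall T', M T' -> selfadjoint T' -> (forall S, D S -> op_le S T') ->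
        op_le T T'].

Definition star_subalgebra M : Prop :=
  [/\ M `<=` BH, M 0,
      (forall (k : R[i]) S T, M S -> M T -> M (k *: S + T)),
      (forall S T, M S -> M T -> M (S \o T))
    & forall T, M T -> M (adj T)].

Definition commutant M : set (H -> H) :=
  [set S | BH S /\ forall T, M T -> S \o T = T \o S].

(** The unit [p] of the von Neumann algebra [M] need not be the identity of
    [H]; the double commutant condition is the one on the space [p H]. A
    factor is of type I when it contains a nonzero abelian projection [q]. *)
Definition type_I_factor M : Prop :=
  star_subalgebra M /\
  exists p, [/\ M p /\ projection p, p <> 0,
    (forall T, M T -> p \o T = T /\ T \o p = T),
    (forall T, commutant (commutant M) T -> p \o T \o p = T -> M T)
  & (forall z, M z -> commutant M z -> exists k : R[i], z = k *: p) /\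
    exists q, [/\ M q, projection q, q <> 0
    & forall S T, M S -> M T ->
        (q \o S \o q) \o (q \o T \o q) = (q \o T \o q) \o (q \o S \o q)]].

Definition corner (p : H -> H) : set (H -> H) :=
  [set p \o T \o p | T in BH].

(** Internal direct sum: bounded operators that are strongly convergent sums
    of elements of the summands. When the summands are corners by mutually
    orthogonal projections, the terms are automatically uniformly bounded. *)
Definition vn_direct_sum (I : choiceType) (M : I -> set (H -> H)) :
    set (H -> H) :=
  [set T | BH T /\ exists2 t : I -> H -> H, (forall i, M i (t i))
    & forall x, has_sum (fun i => t i x) (T x)].

(** Endomorphisms of [M] are maps on all of [H -> H] whose values outside [M]
    are irrelevant. *)
Definition star_endomorphism M (alpha : (H -> H) -> H -> H) : Prop :=
  [/\ forall T, M T -> M (alpha T),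
      forall (k : R[i]) S T, M S -> M T ->
        alpha (k *: S + T) = k *: alpha S + alpha T,
      forall S T, M S -> M T -> alpha (S \o T) = alpha S \o alpha T
    & forall T, M T -> alpha (adj T) = adj (alpha T)].

(** Normality: suprema of bounded increasing nets of self-adjoint elements
    are preserved. *)
Definition normal_map M (alpha : (H -> H) -> H -> H) : Prop :=
  forall (D : set (H -> H)) T, D !=set0 -> D `<=` M ->
    (forall S, D S -> selfadjoint S) ->
    (forall S1 S2, D S1 -> D S2 ->
       exists S3, [/\ D S3, op_le S1 S3 & op_le S2 S3]) ->
    is_op_lub M D T -> is_op_lub M (alpha @` D) (alpha T).

Definition star_representation (A : cstarType R) (tau : A -> H -> H) : Prop :=
  [/\ forall a, BH (tau a), linear tau,
      forall a b, tau (cmul a b) = tau a \o tau b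
    & forall a, tau (cstar a) = adj (tau a)].

End Operators.

(** ** Graphs, their correspondences and Toeplitz algebras *)

(** Countability is not built in: it is asserted of [vert E] and [edge E] where
    a graph is used, since over a nonseparable Hilbert space the edge set may
    have to be uncountable. *)
Record graph := Graph {
  vert : choiceType ;
  edge : choiceType ;
  rng : edge -> vert ;
  src : edge -> vert
}.

Section Toeplitz.
Variables (R : realType) (E : graph).
Local Notation C := R[i].
Implicit Types (x y : edge E -> C) (a b : vert E -> C).

(** C_0(E^0) for the discrete space E^0. *)
Definition C0 : set (vert E -> C) :=
  [set a | forall eps : C, 0 < eps -> finite_set [set v | eps <= `|a v|]].

Definition XE : set (edge E -> C) :=
  [set x | exists2 xhat, C0 xhat & forall v,
    has_sum (K := C) (V := C^o)
      (fun e => if src e == v then `|x e| ^+ 2 else 0) (xhat v)].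

Definition X_right x a : edge E -> C := fun e => x e * a (src e).

Definition X_left a x : edge E -> C := fun e => a (rng e) * x e.

Definition X_inner x y : vert E -> C := fun v =>
  summability.sum (K := C) (R := C^o)
    (fun e => if src e == v then (x e)^* * y e else 0).

Definition delta_edge (e : edge E) : edge E -> C := fun f => (f == e)%:R.

(** A Toeplitz representation of X(E) in [B]: [sigma] and [pi] only matter on
    X(E) and C_0(E^0) respectively. *)
Definition toeplitz_rep (B : cstarType R) (sigma : (edge E -> C) -> B)
    (pi : (vert E -> C) -> B) : Prop :=
  [/\ forall (k : C) x y, XE x -> XE y ->
        sigma (k *: x + y) = k *: sigma x + sigma y,
      [/\ forall (k : C) a b, C0 a -> C0 b ->
            pi (k *: a + b) = k *: pi a + pi b,
          forall a b, C0 a -> C0 b ->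
            pi (fun v => a v * b v) = cmul (pi a) (pi b)
        & forall a, C0 a -> pi (fun v => (a v)^*) = cstar (pi a)],
      forall x a, XE x -> C0 a -> sigma (X_right x a) = cmul (sigma x) (pi a),
      forall x a, XE x -> C0 a -> sigma (X_left a x) = cmul (pi a) (sigma x)
    & forall x y, XE x -> XE y ->
        pi (X_inner x y) = cmul (cstar (sigma x)) (sigma y)].

(** [T] with [sigma_u], [pi_u] is the Toeplitz algebra of X(E), which is
    unique up to a canonical isomorphism. *)
Definition is_toeplitz_algebra (T : cstarType R)
    (sigma_u : (edge E -> C) -> T) (pi_u : (vert E -> C) -> T) : Prop :=
  toeplitz_rep sigma_u pi_u /\
  forall (B : cstarType R) (sigma : (edge E -> C) -> B)
      (pi : (vert E -> C) -> B),
    toeplitz_rep sigma pi ->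
    exists! rho : T -> B,
      [/\ star_hom rho, (forall x, XE x -> sigma x = rho (sigma_u x))
        & (forall a, C0 a -> pi a = rho (pi_u a))].

End Toeplitz.

(* Main.v *)
Require Import Defs.
From HB Require Import structures.
From mathcomp Require Import all_boot all_order all_algebra finmap.
From mathcomp Require Import complex.
From mathcomp Require Import boolp classical_sets functions cardinality reals.
From mathcomp Require Import topology normedtype.
From mathcomp.analysis.showcase Require Import summability.

(** Fix unit vectors [xi i] in the range of [P i]; the range of
    [alpha |xi i><xi i|] is the multiplicity space of [alpha] on the summand
    [W i]. By Zorn's lemma choose a maximal orthonormal set [B] of vectors [b]
    each lying in one of these ranges (which gives its source [i]) and in the
    range of one [P j] (its range vertex); [B] is the edge set of the graph. The
    operators [S_b x = alpha |P_i x><xi_i| b] are partial isometries with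
    [S_b^* S_c = 0] for [b <> c], [S_b^* S_b = P_i], [P_j S_b = S_b] and
    [alpha(w) S_b = S_b w], whence
    [\sum_b S_b w S_b^* = alpha(w) Q] with [Q = \sum_b S_b S_b^*], a projection
    in [W]. By maximality of [B], [alpha] of a rank-one projection of [W] is
    below [Q]; the unit of [W] is the supremum of finite sums of such
    projections, so normality gives [alpha(1) <= Q] and [alpha(w) Q = alpha(w)].
    The relations between the [S_b] and the [P_i] yield a Toeplitz
    representation of [X(E)] in the C*-algebra [B(H)], hence, by universality,
    the representation of the Toeplitz algebra. *)

Set Implicit Arguments.
Unset Strict Implicit.
Unset Printing Implicit Defensive.

Import Order.TTheory GRing.Theory Num.Theory.
Import numFieldNormedType.Exports.

Local Open Scope classical_set_scope.
Local Open Scope ring_scope.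

Local Existing Instance totally_filter.

Local Notation "<< x , y >>" := (inner x y) (format "<< x ,  y >>").

(** * Inner products and unordered sums *)

Section InnerProduct.
Variables (R : realType) (H : hilbertType R).
Local Notation C := R[i].
Implicit Types (x y z : H) (k : C).

Lemma ipC x y : <<x, y>> = <<y, x>>^*.
Proof. by rewrite [LHS]hermC /= expr0 mul1r. Qed.

Lemma ipDl x y z : <<x + y, z>> = <<x, z>> + <<y, z>>.
Proof. exact: linearDl. Qed.

Lemma ipZl k x z : <<k *: x, z>> = k * <<x, z>>.
Proof. exact: linearZl_LR. Qed.

Lemma ipDr x y z : <<x, y + z>> = <<x, y>> + <<x, z>>.
Proof. exact: linearDr. Qed.

Lemma ipZr k x z : <<x, k *: z>> = k^* * <<x, z>>.
Proof. exact: linearZr_LR. Qed.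

Lemma ip0l x : <<0, x>> = 0. Proof. exact: linear0l. Qed.
Lemma ip0r x : <<x, 0>> = 0. Proof. exact: linear0r. Qed.
Lemma ipBl x y z : <<x - y, z>> = <<x, z>> - <<y, z>>. Proof. exact: linearBl. Qed.
Lemma ipBr x y z : <<x, y - z>> = <<x, y>> - <<x, z>>. Proof. exact: linearBr. Qed.

Lemma ipNl x y : <<- x, y>> = - <<x, y>>. Proof. exact: linearNl. Qed.

Lemma ip_suml J (r : seq J) (F : J -> H) z :
  <<\sum_(i <- r) F i, z>> = \sum_(i <- r) <<F i, z>>.
Proof. exact: linear_sumlz. Qed.

Lemma ip_sumr J (r : seq J) (F : J -> H) z :
  <<z, \sum_(i <- r) F i>> = \sum_(i <- r) <<z, F i>>.
Proof. exact: linear_sumr. Qed.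

Lemma ip_ext x y : (forall z, <<x, z>> = <<y, z>>) -> x = y.
Proof.
move=> xy; apply/eqP; rewrite -subr_eq0 -normr_eq0 -sqrf_eq0 -inner_norm.
by rewrite ipBl xy subrr.
Qed.

Lemma ip_extr x y : (forall z, <<z, x>> = <<z, y>>) -> x = y.
Proof. by move=> xy; apply: ip_ext => z; rewrite ipC xy -ipC. Qed.

Lemma ip_eq0C x y : <<x, y>> = 0 -> <<y, x>> = 0.
Proof. by move=> e; rewrite ipC e conjC0. Qed.

(** With [k] the coefficient of the orthogonal projection of [x] onto [y], expanding the nonnegative
    square of [x - k *: y] gives the inequality. *)
Lemma ip_CauchySchwarz x y : `|<<x, y>>| <= `|x| * `|y|.
Proof.
have [->|y0] := eqVneq y 0; first by rewrite ip0r !normr0 mulr0.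
have yy0 : 0 < `|y| ^+ 2 by rewrite exprn_gt0// normr_gt0.
pose k := <<x, y>> / `|y| ^+ 2.
have : 0 <= <<x - k *: y, x - k *: y>> by rewrite inner_norm exprn_ge0.
rewrite ipBl !ipBr !ipZl !ipZr !inner_norm (ipC y x) /k.
set d := `|y| ^+ 2 in yy0 *; set c := <<x, y>>.
have dR : d^* = d by apply/CrealP; rewrite realE ltW.
have -> : (c / d)^* = c^* / d by rewrite rmorphM fmorphV -[in RHS]dR.
have -> : c / d * (c^* / d * d) = c * c^* / d by rewrite divfK ?gt_eqF// mulrAC.
have -> : c^* / d * c = c * c^* / d by rewrite mulrAC (mulrC c^*).
rewrite (mulrAC c d^-1) subrr subr0 -normCK.
by rewrite subr_ge0 ler_pdivrMr// -exprMn ler_sqr ?nnegrE ?mulr_ge0.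
Qed.

Lemma pythagoras_sum (J : eqType) (r : seq J) (F : J -> H) : uniq r ->
  {in r &, forall i j, i != j -> <<F i, F j>> = 0} ->
  `|\sum_(i <- r) F i| ^+ 2 = \sum_(i <- r) `|F i| ^+ 2.
Proof.
move=> ur oF; rewrite -inner_norm ip_suml [LHS]big_seq [RHS]big_seq; apply: eq_bigr => i ir.
rewrite ip_sumr (bigD1_seq i)//= -inner_norm big_seq_cond big1 ?addr0// => j /andP[jr ji].
by apply: oF => //; rewrite eq_sym.
Qed.

Lemma ip_continuousl y : continuous (fun x : H => <<x, y>> : C^o).
Proof.
move=> x; apply/cvgrPdist_lt => e e0.
have y1 : 0 < `|y| + 1 by rewrite ltr_wpDl.
near=> z; rewrite -ipBl (le_lt_trans (ip_CauchySchwarz _ _))//.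
apply: (@le_lt_trans _ _ (`|x - z| * (`|y| + 1))).
  by rewrite ler_wpM2l// lerDl.
rewrite -ltr_pdivlMr//; near: z; apply: cvgr_dist_lt => //.
by rewrite divr_gt0.
Unshelve. all: by end_near. Qed.

Lemma ip_continuousr x : continuous (fun y : H => <<x, y>> : C^o).
Proof.
move=> y; apply/cvgrPdist_lt => e e0.
have /cvgrPdist_lt/(_ e e0) := @ip_continuousl x y; apply: filterS => z /=.
by rewrite -ipBl -ipBr (ipC x) norm_conjC.
Qed.

End InnerProduct.

Section HasSum.
Context {K : numFieldType} {V : normedModType K} {I : choiceType}.
Implicit Types (f g : I -> V) (l m : V) (A B : {fset I}).

Lemma partial_sumE f A : partial_sum f A = \sum_(i <- A) f i.
Proof. by rewrite /partial_sum big_seq_fsetE. Qed.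

Lemma has_sumP f l : has_sum f l <->
  forall e : K, 0 < e -> exists A, forall B, (A `<=` B)%fset ->
    `|l - \sum_(i <- B) f i| < e.
Proof.
split=> [fl e e0|fl].
- have /cvgrPdist_lt/(_ e e0)[A _ sA] := fl.
  by exists A => B AB; rewrite -partial_sumE; exact: sA.
- apply/cvgrPdist_lt => e e0; have [A sA] := fl e e0.
  by exists A => // B AB /=; rewrite partial_sumE; exact: sA.
Qed.

Lemma has_sum_unique f l m : has_sum f l -> has_sum f m -> l = m.
Proof. exact: norm_cvg_unique. Qed.

Lemma eq_has_sum f g l : f =1 g -> has_sum f l -> has_sum g l.
Proof. by move=> /funext ->. Qed.

Lemma has_sum_finite A f : (forall i, i \notin A -> f i = 0) ->
  has_sum f (\sum_(i <- A) f i).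
Proof.
move=> f0; apply/has_sumP => e e0; exists A => B AB.
rewrite (big_fset_incl _ AB)// ?subrr ?normr0// => i iB; exact: f0.
Qed.

Lemma has_sum1 j f : (forall i, i != j -> f i = 0) -> has_sum f (f j).
Proof.
move=> f0; have := @has_sum_finite [fset j]%fset f; rewrite big_seq_fset1; apply=> i.
by rewrite inE => /f0.
Qed.

Lemma has_sum_bounded f l (M : K) : has_sum f l ->
  (forall A, `|\sum_(i <- A) f i| <= M) -> `|l| <= M.
Proof.
move=> /has_sumP fl fM; apply/ler_addgt0Pl => e /fl[A /(_ A (fsubset_refl _)) /ltW fA].
by rewrite -(subrK (\sum_(i <- A) f i) l) (le_trans (ler_normD _ _))// lerD.
Qed.

End HasSum.

Lemma has_sum_map (K : numFieldType) (U V : normedModType K) (I : choiceType)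
    (T : U -> V) (f : I -> U) (l : U) : {morph T : x y / x + y} ->
  {for l, continuous T} -> has_sum f l -> has_sum (T \o f) (T l).
Proof.
move=> TD cT fl; rewrite /has_sum.
have T0 : T 0 = 0 by apply: (addrI (T 0)); rewrite -TD !addr0.
have -> : partial_sum (T \o f) = T \o partial_sum f.
  apply/funext => A /=; rewrite !partial_sumE.
  by elim/big_rec2: _ => [|i y x _ ->]; rewrite ?T0 ?TD.
exact: cvg_comp fl cT.
Qed.

Lemma has_sum_lincomb (K : numFieldType) (V : normedModType K) (I : choiceType)
    (k : K) (f g : I -> V) (l m : V) : has_sum f l -> has_sum g m ->
  has_sum (fun i => k *: f i + g i) (k *: l + m).
Proof.
move=> fl gm; rewrite /has_sum.
have -> : partial_sum (fun i => k *: f i + g i) =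
    (fun A => k *: partial_sum f A + partial_sum g A).
  by apply/funext => A; rewrite !partial_sumE big_split/= -scaler_sumr.
apply: cvgD => //; apply: cvgZl_tmp; exact: fl.
Qed.
Arguments has_sum_lincomb {K V I} k {f g l m} _ _ _ _.

(** * Suprema of bounded sets of nonnegative complex numbers *)

Section ComplexSup.
Variable R : realType.
Local Notation C := R[i].
Implicit Types (E : set C) (x y e M : C).

(** The order of [R[i]] is partial, so the supremum is taken over real parts and embedded back. It
    is a least upper bound for nonempty bounded sets of nonnegative elements. *)
Definition csup E : C := real_complex R (sup [set complex.Re x | x in E]).

Lemma ger0_ReK x : 0 <= x -> real_complex R (complex.Re x) = x.
Proof. by move=> x0; apply: RRe_real; rewrite realE x0. Qed.

Lemma ger0_Re_le x y : 0 <= x -> 0 <= y -> (complex.Re x <= complex.Re y) = (x <= y).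
Proof. by move=> x0 y0; rewrite -lecR !ger0_ReK. Qed.

Variables (E : set C) (M : C).
Hypotheses (E_nonempty : E !=set0) (E_ge0 : forall x, E x -> 0 <= x)
  (E_le : forall x, E x -> x <= M).

Let M_ge0 : 0 <= M.
Proof. by have [x Ex] := E_nonempty; apply: le_trans (E_le Ex); exact: E_ge0. Qed.

Let has_supE : has_sup [set complex.Re x | x in E].
Proof.
have [x Ex] := E_nonempty; split; first by exists (complex.Re x), x.
by exists (complex.Re M) => _ [y Ey <-]; rewrite ger0_Re_le// ?E_le// E_ge0.
Qed.

Lemma csup_upper_bound x : E x -> x <= csup E.
Proof.
move=> Ex; rewrite -[x]ger0_ReK ?E_ge0// lecR.
by apply: (sup_upper_bound has_supE); exists x.
Qed.

Lemma csup_ge0 : 0 <= csup E.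
Proof. by have [x Ex] := E_nonempty; rewrite (le_trans (E_ge0 Ex))// csup_upper_bound. Qed.

Lemma csup_le : csup E <= M.
Proof.
rewrite -[M]ger0_ReK// lecR; apply: ge_sup; first by have [] := has_supE.
by move=> _ [x Ex <-]; rewrite ger0_Re_le// ?E_le// E_ge0.
Qed.

Lemma csup_adherent e : 0 < e -> exists2 x, E x & csup E - e < x.
Proof.
move=> e0; have Re0 : 0 < complex.Re e by move: e0; rewrite ltcE => /andP[].
have [_ [x Ex <-] lt_x] := sup_adherent Re0 has_supE.
exists x => //; rewrite -[e]ger0_ReK 1?ltW// -[x]ger0_ReK ?E_ge0//.
by rewrite -rmorphB ltcR.
Qed.

End ComplexSup.

Lemma big_fset_subset (V : nmodType) (I : choiceType) (f : I -> V) (A B : {fset I}) :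
  (A `<=` B)%fset ->
  \sum_(i <- B) f i = \sum_(i <- A) f i + \sum_(i <- (B `\` A)%fset) f i.
Proof.
move=> AB; rewrite (big_fsetID _ (mem A) B)/=; congr (_ + _); apply: eq_fbigl => i.
  by rewrite !inE/=; apply: andb_idl => /(fsubsetP AB).
by rewrite !inE andbC.
Qed.

(** * Convergence of orthogonal families and maximal orthonormal sets *)

Section OrthogonalSums.
Context {R : realType} {H : hilbertType R} {I : choiceType}.
Local Notation C := R[i].

(** Once the sum of squares over [A] is within [e ^+ 2] of its supremum, Pythagoras bounds by [e]
    the change made by enlarging [A]. The partial sums are therefore Cauchy, and [H] is complete. *)
Lemma orthogonal_has_sum (y : I -> H) (M : C) :
  (forall i j, i != j -> <<y i, y j>> = 0) ->
  (forall A : {fset I}, \sum_(i <- A) `|y i| ^+ 2 <= M) ->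
  exists l, has_sum y l.
Proof.
move=> oy yM; pose s (A : {fset I}) := \sum_(i <- A) `|y i| ^+ 2.
have s_ge0 A : 0 <= s A by apply: sumr_ge0 => i _; rewrite exprn_ge0.
have E0 : range s !=set0 by exists (s fset0), fset0.
have E_ge0 x : range s x -> 0 <= x by move=> [A _ <-].
have E_le x : range s x -> x <= M by move=> [A _ <-]; exact: yM.
suff /cauchy_cvgP cv : cauchy (partial_sum y @ totally).
  by exists (lim (partial_sum y @ totally)).
apply: cauchy_exP => e e0.
have [_ [A _ <-] sA] := csup_adherent E0 E_ge0 E_le (exprn_gt0 2 e0).
exists (partial_sum y A); exists A => // B AB.
rewrite /= -ball_normE /= -ltr_sqr ?nnegrE ?(ltW e0)// !partial_sumE.
rewrite (big_fset_subset _ AB) opprD addNKr normrN pythagoras_sum//; last first.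
  by move=> i j _ _; exact: oy.
rewrite -(ltrD2l (s A)) -big_fset_subset// (@le_lt_trans _ _ (csup (range s)))//.
  by apply: (csup_upper_bound E0 E_ge0 E_le); exists B.
by rewrite -ltrBlDr.
Qed.
End OrthogonalSums.

Section Orthonormal.
Context {R : realType} {H : hilbertType R}.
Local Notation C := R[i].

Definition orthonormal_set (B : set H) :=
  (forall b, B b -> `|b| = 1) /\ (forall b c, B b -> B c -> b != c -> <<b, c>> = 0).

(** Zorn applies because two vectors in the union of a chain already lie in one member of it. A unit
    vector of [G] orthogonal to [B] is not in [B], so adjoining it would contradict maximality. *)
Lemma maximal_orthonormal (G : set H) : (forall g, G g -> `|g| = 1) ->
  exists B, [/\ B `<=` G, orthonormal_set B
    & forall g, G g -> (forall b, B b -> <<g, b>> = 0) -> False].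
Proof.
move=> G1; pose P B := B `<=` G /\ orthonormal_set B.
have [|B [[BG oB] maxB]] := @Zorn_bigcup H P.
  move=> F FP totF; split; first by move=> x [X /FP[+ _]] Xx; exact.
  split=> [b [X /FP[_ [+ _]]]|b c [X FX Xb] [Y FY Yc] bc]; first exact.
  have [_ [_ oX]] := FP _ FX; have [_ [_ oY]] := FP _ FY.
  by have [XY|YX] := totF _ _ FX FY; [apply: oY => //; exact: XY | apply: oX => //; exact: YX].
exists B; split=> // g Gg gB; have Bg : ~ B g.
  move=> /gB; rewrite inner_norm G1// expr1n => /eqP; rewrite oner_eq0//.
apply: (maxB (B `|` [set g])).
  by split; [exact: subsetUl | move=> BgB; apply: Bg; apply: BgB; right].
have [B1 B2] := oB; split=> [x [/BG//|->//]|]; split=> [x [/B1//|->]|]; first exact: G1.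
move=> b c [Bb|->] [Bc|->] bc; [exact: B2|exact/ip_eq0C/gB|exact: gB|by rewrite eqxx in bc].
Qed.

End Orthonormal.

(** * Bounded operators and adjoints *)

Section BoundedOperators.
Context {R : realType} {H : hilbertType R}.
Local Notation C := R[i].
Implicit Types (S T p q : H -> H) (x y z : H) (k : C).

Section LinearMaps.
Variables (T : H -> H) (lT : linear T).

Lemma linearDf x y : T (x + y) = T x + T y.
Proof. by rewrite -[x in T (x + y)]scale1r lT scale1r. Qed.

Lemma linear0f : T 0 = 0.
Proof. by apply: (addrI (T 0)); rewrite -linearDf !addr0. Qed.

Lemma linearZf k x : T (k *: x) = k *: T x.
Proof. by rewrite -[k *: x]addr0 lT linear0f addr0. Qed.

Lemma linearBf x y : T (x - y) = T x - T y.
Proof. by rewrite linearDf -scaleN1r linearZf scaleN1r. Qed.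

Lemma linear_sumf J (r : seq J) (F : J -> H) :
  T (\sum_(i <- r) F i) = \sum_(i <- r) T (F i).
Proof. by elim/big_rec2: _ => [|i y x _ <-]; rewrite (linear0f, linearDf). Qed.

End LinearMaps.

Lemma BH_linear T : BH T -> linear T. Proof. by case. Qed.

Lemma bounded_BH T (M : C) : linear T -> (forall x, `|T x| <= M * `|x|) -> BH T.
Proof.
move=> lT TM; split=> // x; apply/cvgrPdist_lt => e e0.
(* [M] is not assumed nonnegative or even real; the bound itself forces [0 <= M] as soon as it is
   tested on a nonzero vector. *)
have M1 : 0 < `|M| + 1 by rewrite ltr_wpDl.
near=> z; rewrite -linearBf//.
have : `|T (x - z)| <= (`|M| + 1) * `|x - z|.
  have := TM (x - z); have [->|xz] := eqVneq (x - z) 0.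
    by rewrite linear0f// !normr0 !mulr0.
  have xz0 : 0 < `|x - z| by rewrite normr_gt0.
  move=> Txz; have M0 : 0 <= M.
    by rewrite -(pmulr_lge0 _ xz0) (le_trans _ Txz).
  by rewrite (le_trans Txz)// ler_wpM2r// ger0_norm// lerDl.
move=> /le_lt_trans; apply; rewrite mulrC -ltr_pdivlMr//; near: z.
by apply: cvgr_dist_lt => //; rewrite divr_gt0.
Unshelve. all: by end_near. Qed.

(** Continuity at 0 sends a ball of radius [d] into the unit ball; rescaling [x] to length [d / 2]
    gives the constant [2 / d]. *)
Lemma BH_bounded T : BH T -> exists2 M : C, 0 < M & forall x, `|T x| <= M * `|x|.
Proof.
move=> [lT cT]; have /cvgrPdist_lt/(_ 1 ltr01) := cT 0; rewrite linear0f//.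
move=> /nbhs_ballP[d /= d0 dT]; exists (2 / d); first by rewrite divr_gt0.
move=> x; have [->|x0] := eqVneq x 0; first by rewrite linear0f// !normr0 mulr0.
have nx0 : 0 < `|x| by rewrite normr_gt0.
pose c := d / 2 / `|x|; have c0 : 0 < c by rewrite !divr_gt0.
have nZ (y : H) : `|c *: y| = c * `|y| by rewrite normrZ gtr0_norm.
have /= := dT (c *: x); rewrite -ball_normE /= !sub0r !normrN nZ divfK ?gt_eqF//.
rewrite linearZf// nZ ltr_pdivrMr// ltr_pMr// ltr1n => /(_ isT)/ltW.
rewrite -ler_pdivlMl// mulr1 => /le_trans; apply.
by rewrite /c invf_div [leLHS]mulrC invf_div.
Qed.

Lemma BH_has_sum T (I : choiceType) (f : I -> H) l :
  BH T -> has_sum f l -> has_sum (fun i => T (f i)) (T l).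
Proof. by move=> [lT cT]; apply: (has_sum_map (T := T)); [exact: linearDf|exact: cT]. Qed.

Lemma has_sum_ipl (I : choiceType) (f : I -> H) l z :
  has_sum f l -> has_sum (V := C^o) (fun i => <<f i, z>> : C^o) <<l, z>>.
Proof.
apply: (has_sum_map (V := C^o) (T := fun x => <<x, z>> : C^o)).
  by move=> x y; exact: ipDl.
exact: ip_continuousl.
Qed.

Lemma has_sum_ipr (I : choiceType) (f : I -> H) l z :
  has_sum f l -> has_sum (V := C^o) (fun i => <<z, f i>> : C^o) <<z, l>>.
Proof.
apply: (has_sum_map (V := C^o) (T := fun x => <<z, x>> : C^o)).
  by move=> x y; exact: ipDr.
exact: ip_continuousr.
Qed.

Arguments has_sum_ipl {I f l} z _.
Arguments has_sum_ipr {I f l} z _.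

Lemma adjointable_linear S T : (forall x y, <<S x, y>> = <<x, T y>>) -> linear S.
Proof. by move=> ST k x y; apply: ip_ext => z; rewrite ST !(ipDl, ipZl) !ST. Qed.

(** Inner products determine a vector, so exhibiting a formal adjoint computes [adj] with no prior
    proof that adjoints exist. *)
Lemma adj_unique S T : (forall x y, <<S x, y>> = <<x, T y>>) -> adj S = T.
Proof.
move=> ST; apply/funext => y; apply: xget_unique => //= z Sz.
by apply: ip_extr => x; rewrite -ST Sz.
Qed.

Lemma ip_norm_le x y : <<x, y>> = `|x| ^+ 2 -> `|x| <= `|y|.
Proof.
have [->|x0] := eqVneq x 0; first by rewrite normr0.
have nx0 : 0 < `|x| by rewrite normr_gt0.
move=> xy; have := ip_CauchySchwarz x y; rewrite xy ger0_norm ?exprn_ge0//.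
by rewrite expr2 ler_pM2l.
Qed.

(** Symmetry forces linearity, and with idempotence it gives [<<p x, x>> = |p x|^2], so [p] is a
    contraction by Cauchy-Schwarz. *)
Lemma projectionI p : (forall x, p (p x) = p x) ->
  (forall x y, <<p x, y>> = <<x, p y>>) -> projection p.
Proof.
move=> pp sp; split; [|exact/funext|exact: adj_unique].
apply: (@bounded_BH _ 1); first exact: adjointable_linear sp.
by move=> x; rewrite mul1r; apply: ip_norm_le; rewrite -inner_norm -sp pp.
Qed.

(* The operator written |x><y| in bra-ket notation. *)
Definition rank1 x y : H -> H := fun z => <<z, y>> *: x.

Lemma rank1_ip x y z w : <<rank1 x y z, w>> = <<z, rank1 y x w>>.
Proof. by rewrite ipZl ipZr -ipC mulrC. Qed.

Lemma BH_rank1 x y : BH (rank1 x y).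
Proof.
apply: (@bounded_BH _ (`|x| * `|y|)).
  exact: adjointable_linear (rank1_ip x y).
by move=> z; rewrite normrZ mulrC -mulrA ler_wpM2l// mulrC ip_CauchySchwarz.
Qed.

Lemma projection_linear p : projection p -> linear p.
Proof. by case=> -[]. Qed.

(** A partial sum [s] at [x] satisfies [<<s, x>> = |s|^2], hence [|s| <= |x|], and orthogonality
    gives convergence. This serves for orthonormal vectors, for the unit of the direct sum and for
    the ranges of the edge operators. *)
Lemma sum_of_projections (I : choiceType) (p : I -> H -> H) :
  (forall i x, p i (p i x) = p i x) ->
  (forall i x y, <<p i x, y>> = <<x, p i y>>) ->
  (forall i j x, i != j -> p i (p j x) = 0) ->
  exists q, [/\ projection q, (forall x, has_sum (fun i => p i x) (q x)),
    (forall i x, p i (q x) = p i x) & forall i x, q (p i x) = p i x].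
Proof.
move=> pp sp op.
have lp i : linear (p i) by exact: adjointable_linear (sp i).
have ex x : exists l, has_sum (fun i => p i x) l.
  apply: (@orthogonal_has_sum _ _ _ _ (`|x| ^+ 2)) => [i j ij|A].
    by rewrite sp op// ip0r.
  rewrite -(@pythagoras_sum _ _ _ _ (fun i => p i x)) ?fset_uniq//; last first.
    by move=> i j _ _ ij; rewrite sp op// ip0r.
  rewrite ler_sqr ?nnegrE//; apply: ip_norm_le.
  rewrite -inner_norm !ip_suml [LHS]big_seq [RHS]big_seq.
  apply: eq_bigr => i iA; rewrite ip_sumr (big_fsetD1 i)//= big_seq big1 ?addr0.
    by rewrite -sp pp.
  by move=> j; rewrite !inE eq_sym => /andP[ij _]; rewrite sp op// ip0r.
have [q qE] := choice ex.
have cp i : BH (p i) by have [] := projectionI (pp i) (sp i).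
have pq i x : p i (q x) = p i x.
  apply: has_sum_unique (BH_has_sum (cp i) (qE x)) _.
  rewrite -[X in has_sum _ X]pp; apply: (has_sum1 (f := fun j => p i (p j x))).
  by move=> j ji; rewrite op// eq_sym.
have qp i x : q (p i x) = p i x.
  apply: has_sum_unique (qE (p i x)) _.
  rewrite -[X in has_sum _ X]pp; apply: (has_sum1 (f := fun j => p j (p i x))).
  by move=> j ji; rewrite op.
exists q; split=> //; apply: projectionI => [x|x y].
  by apply: has_sum_unique (qE _) _; apply: eq_has_sum (qE x) => i; rewrite pq.
apply: (has_sum_unique (V := C^o)) (has_sum_ipl y (qE x)) _.
by apply: (eq_has_sum (V := C^o)) (has_sum_ipr x (qE y)) => i; rewrite sp.
Qed.

(** The last clause says that [x - q x] is orthogonal to [B], the form in which maximality of [B]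
    gets contradicted. *)
Lemma orthonormal_rank1 (B : set H) : orthonormal_set B ->
  exists q, [/\ projection q,
    (forall x, has_sum (fun b : set_type B => rank1 (val b) (val b) x) (q x))
    & forall b x, B b -> <<q x, b>> = <<x, b>>].
Proof.
move=> [B1 oB].
have [] := @sum_of_projections (set_type B) (fun b => rank1 (val b) (val b)).
- move=> b x; rewrite /rank1 ipZl inner_norm B1 ?expr1n ?mulr1//.
  exact: (set_valP b).
- by move=> b x y; exact: rank1_ip.
- move=> b c x bc; have cb : <<val c, val b>> = 0.
    by apply: oB; [exact: (set_valP c)|exact: (set_valP b)|rewrite eq_sym].
  by rewrite /rank1 ipZl cb mulr0 scale0r.
move=> q [pq qE pq' _]; exists q; split=> // b x Bb.
have := pq' (SigSub (mem_set Bb)) x; rewrite /rank1/= => /(congr1 (inner^~ b)).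
by rewrite !ipZl inner_norm B1// expr1n !mulr1.
Qed.

Lemma orthonormal_basis : exists2 B, orthonormal_set B
  & forall x, has_sum (fun b : set_type B => rank1 (val b) (val b) x) x.
Proof.
have [B [_ oB maxB]] := @maximal_orthonormal _ H [set x | `|x| = 1] (fun=> id).
have [q [pq qE qb]] := orthonormal_rank1 oB; exists B => // x.
rewrite -[X in has_sum _ X](_ : q x = x)//; apply/esym.
apply/eqP; rewrite -subr_eq0; apply: contrapT => /negP xqx.
apply: (maxB (`|x - q x|^-1 *: (x - q x))); first exact: normfZV.
by move=> b Bb; rewrite ipZl ipBl qb// subrr mulr0.
Qed.

(* Expand in an orthonormal basis [b]: the value of the adjoint at [y] is
   [\sum_b <<T b, y>>^* b], a convergent sum because [T] is bounded. *)
Lemma adj_exists T : BH T -> exists S, forall x y, <<T x, y>> = <<x, S y>>.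
Proof.
move=> bT; suff /choice[S ST] : forall y, exists z, forall x, <<T x, y>> = <<x, z>>.
  by exists S => x y.
move=> y; have [B [B1 oB] BE] := orthonormal_basis.
have [M M0 TM] := BH_bounded bT.
have o (b c : set_type B) : b != c -> <<val b, val c>> = 0.
  by move=> bc; apply: oB; [exact: (set_valP b)|exact: (set_valP c)|].
have n1 (b : set_type B) : `|val b| = 1 by apply: B1; exact: (set_valP b).
have [] := @orthogonal_has_sum _ H _ (fun b : set_type B => <<T (val b), y>>^* *: val b)
  ((M * `|y|) ^+ 2).
- by move=> b c bc; rewrite ipZl ipZr o// !mulr0.
- move=> A; set s := \sum_(b <- A) <<T (val b), y>>^* *: val b.
  have sE : \sum_(b <- A) `|<<T (val b), y>>^* *: val b| ^+ 2 = `|s| ^+ 2.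
    rewrite pythagoras_sum ?fset_uniq// => b c _ _ bc.
    by rewrite ipZl ipZr o// !mulr0.
  rewrite sE.
  (* The coefficients are chosen so that [<<T s, y>> = |s|^2]; Cauchy-Schwarz and the bound on [T]
     then give [|s| <= M * |y|]. *)
  have Ts : <<T s, y>> = `|s| ^+ 2.
    rewrite -sE linear_sumf ?ip_suml; last exact: BH_linear.
    apply: eq_bigr => b _; rewrite linearZf; last exact: BH_linear.
    by rewrite ipZl normrZ n1 mulr1 norm_conjC normCK mulrC.
  have My0 : 0 <= M * `|y| by rewrite mulr_ge0// ltW.
  rewrite ler_sqr ?nnegrE//.
  have [->|s0] := eqVneq s 0; first by rewrite normr0.
  have ns0 : 0 < `|s| by rewrite normr_gt0.
  rewrite -(ler_pM2l ns0) -expr2 -Ts -[leLHS]ger0_norm ?Ts ?exprn_ge0// -Ts.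
  rewrite (le_trans (ip_CauchySchwarz _ _))// mulrA ler_wpM2r// mulrC; exact: TM.
move=> z zE; exists z => x.
apply: (has_sum_unique (V := C^o)) (has_sum_ipl y (BH_has_sum bT (BE x))) _.
apply: (eq_has_sum (V := C^o)) (has_sum_ipr x zE) => b.
by rewrite /rank1 linearZf ?ipZl ?ipZr ?conjCK 1?mulrC//; exact: BH_linear.
Qed.

End BoundedOperators.

Arguments has_sum_ipl {R H I f l} z _.
Arguments has_sum_ipr {R H I f l} z _.

Section Adjoints.
Context {R : realType} {H : hilbertType R}.
Local Notation C := R[i].
Implicit Types (S T p q : H -> H) (x y z : H) (k : C).

Lemma adjE T x y : BH T -> <<T x, y>> = <<x, adj T y>>.
Proof. by move=> /adj_exists[S ST]; rewrite (adj_unique ST). Qed.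

Lemma adjEl T x y : BH T -> <<adj T x, y>> = <<x, T y>>.
Proof. by move=> bT; rewrite ipC -adjE// -ipC. Qed.

Lemma adjK T : BH T -> adj (adj T) = T.
Proof. by move=> bT; apply: adj_unique => x y; rewrite adjEl. Qed.

Lemma BH_comp S T : BH S -> BH T -> BH (S \o T).
Proof.
move=> [lS cS] [lT cT]; split=> [k x y /=|x]; first by rewrite lT lS.
by apply: continuous_comp; [exact: cT|exact: cS].
Qed.

Lemma BH_lincomb k S T : BH S -> BH T -> BH (k *: S + T).
Proof.
move=> [lS cS] [lT cT]; split=> [c x y|x].
  rewrite !fctE lS lT !scalerDr !scalerA mulrC !addrA; congr (_ + _).
  by rewrite addrAC.
by apply: cvgD; [apply: cvgZl_tmp; exact: cS|exact: cT].
Qed.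

Lemma BH_zero : BH (0 : H -> H).
Proof. by split=> [k x y|x]; [rewrite scaler0 addr0|exact: cvg_cst]. Qed.

(** The square of the norm of [adj T y] is [<<T (adj T y), y>>]; bound it by Cauchy-Schwarz and
    cancel one factor. *)
Lemma norm_adj_le T (M : C) y : BH T -> 0 <= M -> (forall x, `|T x| <= M * `|x|) ->
  `|adj T y| <= M * `|y|.
Proof.
move=> bT M0 TM.
have [->|y0] := eqVneq (adj T y) 0; first by rewrite normr0 mulr_ge0.
have ny0 : 0 < `|adj T y| by rewrite normr_gt0.
rewrite -(ler_pM2l ny0) -expr2 -[leLHS]ger0_norm ?exprn_ge0// -inner_norm -adjE//.
rewrite (le_trans (ip_CauchySchwarz _ _))// mulrA ler_wpM2r// mulrC; exact: TM.
Qed.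

Lemma BH_adj T : BH T -> BH (adj T).
Proof.
move=> bT; have [M M0 TM] := BH_bounded bT.
apply: (@bounded_BH _ _ _ M); first by apply: adjointable_linear => x y; exact: adjEl.
by move=> y; apply: norm_adj_le => //; exact: ltW.
Qed.

Lemma adj_comp S T : BH S -> BH T -> adj (S \o T) = adj T \o adj S.
Proof. by move=> bS bT; apply: adj_unique => x y /=; rewrite !adjE. Qed.

Lemma adj_lincomb k S T : BH S -> BH T -> adj (k *: S + T) = k^* *: adj S + adj T.
Proof.
move=> bS bT; apply: adj_unique => x y.
by rewrite !fctE ipDl ipDr ipZl ipZr conjCK !adjE.
Qed.

Lemma adj_rank1 x y : adj (rank1 x y) = rank1 y x.
Proof. by apply: adj_unique => z w; exact: rank1_ip. Qed.

End Adjoints.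

(** * The C*-algebra of bounded operators *)

Section BoundedOperatorAlgebra.
Context {R : realType} (H : hilbertType R).
Local Notation C := R[i].

Definition BH_pred : {pred H -> H} := fun T => `[< BH T >].

(** The universal property of the Toeplitz algebra takes values in a [cstarType], so B(H) is bundled
    as a subtype that inherits the module structure of [H -> H]. *)
Record bop := Bop { bop_fun :> H -> H; bopP : bop_fun \in BH_pred }.

HB.instance Definition _ := [isSub for bop_fun].
HB.instance Definition _ := [Choice of bop by <:].

Lemma BH_submod_closed : submod_closed BH_pred.
Proof.
split; first by apply/asboolP; exact: BH_zero.
by move=> k S T /asboolP bS /asboolP bT; apply/asboolP; exact: BH_lincomb.
Qed.

HB.instance Definition _ := GRing.isSubmodClosed.Build C (H -> H) BH_pred BH_submod_closed.
HB.instance Definition _ := [SubChoice_isSubLmodule of bop by <:].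

Implicit Types (S T : bop) (x y : H).

Lemma bop_BH T : BH T. Proof. exact: (asboolP _ (bopP T)). Qed.

Definition bop_of (T : H -> H) (bT : BH T) : bop := Bop (asboolT bT).

(** The closed ball, unlike the sphere, is nonempty even when [H] is zero. *)
Definition opnorm T : C := csup [set `|T x| | x in [set x | `|x| <= 1]].

Let opset T : set C := [set `|T x| | x in [set x | `|x| <= 1]].

Let opset_nonempty T : opset T !=set0.
Proof. by exists `|T 0|, 0 => //=; rewrite normr0. Qed.

Let opset_ge0 T (c : C) : opset T c -> 0 <= c.
Proof. by move=> [x _ <-]. Qed.

Let opset_le T : exists2 M : C, 0 < M & forall c, opset T c -> c <= M.
Proof.
have [M M0 TM] := BH_bounded (bop_BH T); exists M => // _ [x /= x1 <-].
by rewrite (le_trans (TM x))// ler_piMr// ltW.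
Qed.

Lemma opnorm_ge0 T : 0 <= opnorm T.
Proof.
have [M _ TM] := opset_le T.
exact: (csup_ge0 (@opset_nonempty T) (@opset_ge0 T) TM).
Qed.

Lemma opnorm_apply T x : `|T x| <= opnorm T * `|x|.
Proof.
have lT := BH_linear (bop_BH T).
have [->|x0] := eqVneq x 0; first by rewrite linear0f// !normr0 mulr0.
have [M _ TM] := opset_le T; have nx0 : 0 < `|x| by rewrite normr_gt0.
rewrite -ler_pdivrMr// mulrC -[X in X * _]ger0_norm ?invr_ge0// -normrZ -linearZf//.
apply: (csup_upper_bound (@opset_nonempty T) (@opset_ge0 T) TM).
by exists (`|x|^-1 *: x) => //=; rewrite normfZV.
Qed.

Lemma opnorm_le T (M : C) : 0 <= M -> (forall x, `|T x| <= M * `|x|) -> opnorm T <= M.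
Proof.
move=> M0 TM; apply: (csup_le (@opset_nonempty T) (@opset_ge0 T)) => _ [x /= x1 <-].
by rewrite (le_trans (TM x))// ler_piMr.
Qed.

Lemma opnormD S T : opnorm (S + T) <= opnorm S + opnorm T.
Proof.
apply: opnorm_le => [|x]; first by rewrite addr_ge0 ?opnorm_ge0.
by rewrite (le_trans (ler_normD _ _))// mulrDl lerD// opnorm_apply.
Qed.

Lemma opnormZ_le (k : C) T : opnorm (k *: T) <= `|k| * opnorm T.
Proof.
apply: opnorm_le => [|x]; first by rewrite mulr_ge0 ?opnorm_ge0.
by rewrite normrZ -mulrA ler_wpM2l// opnorm_apply.
Qed.

Lemma opnormZ (k : C) T : opnorm (k *: T) = `|k| * opnorm T.
Proof.
apply/le_anti; rewrite opnormZ_le andTb; have [->|k0] := eqVneq k 0.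
  by rewrite normr0 mul0r opnorm_ge0.
rewrite -ler_pdivlMl ?normr_gt0// -normfV -[in leLHS](scalerK k0 T).
exact: opnormZ_le.
Qed.

Lemma opnorm_eq0 T : opnorm T = 0 -> T = 0.
Proof.
move=> T0; apply/val_inj/funext => x; apply/eqP; rewrite -normr_le0.
by have := opnorm_apply T x; rewrite T0 mul0r.
Qed.

HB.instance Definition _ := Lmodule_isNormed.Build C bop opnormD opnormZ opnorm_eq0.

Lemma bop_normE T : `|T| = opnorm T. Proof. by []. Qed.

(** The pointwise limit [L] exists by completeness of [H]. Passing to the limit in
    [|T x - S x| <= e * |x|], uniformly in [x], shows both that [L] is bounded and that convergence
    holds in norm. *)
Lemma bop_complete (F : set_system bop) : ProperFilter F -> cauchy F -> cvg F.
Proof.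
move=> FF /cauchyP cF.
have dist S T x (e : C) : `|S - T| < e -> `|S x - T x| <= e * `|x|.
  by move=> /ltW ST; rewrite (le_trans (opnorm_apply (S - T) x))// ler_wpM2r.
have cx x : cvg ((fun T : bop => T x) @ F).
  apply/cauchy_cvgP/cauchy_exP => e e0.
  have x1 : 0 < `|x| + 1 by rewrite ltr_wpDl.
  have [T FT] := cF _ (divr_gt0 e0 x1); exists (T x).
  rewrite -ball_normE; apply: (@filterS _ F _ _ _ _ FT) => S; rewrite -ball_normE /= => TS.
  apply: le_lt_trans (dist _ _ x _ TS) _.
  by rewrite mulrAC ltr_pdivrMr// ltr_pM2l// ltrDl.
pose L x := lim ((fun T : bop => T x) @ F).
have LE x : (fun T : bop => T x) @ F --> L x by exact: cx.
have LT (e : C) T : 0 < e -> F (ball T e) -> forall x, `|T x - L x| <= e * `|x|.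
  move=> e0 FT x; apply/ler_addgt0Pl => d d0.
  have /cvgrPdist_lt/(_ d d0) FL := LE x.
  have [S []] := filter_ex (filterI FL FT); rewrite /= -ball_normE /= => /ltW SL TS.
  have {}TS := dist _ _ x _ TS.
  by rewrite -(subrK (S x) (T x)) -addrA (le_trans (ler_normD _ _))// [leRHS]addrC lerD// distrC.
have [T0 FT0] := cF 1 ltr01; have {}LT0 := LT _ _ ltr01 FT0.
have lL : linear L.
  move=> k x y; apply: (norm_cvg_unique (LE (k *: x + y))).
  rewrite (_ : (fun T : bop => _) = (fun T : bop => k *: T x + T y)).
    by apply: cvgD; [apply: cvgZl_tmp; exact: LE|exact: LE].
  by apply/funext => T; exact: BH_linear (bop_BH T) _ _ _.
have bL : BH L.
  apply: (@bounded_BH _ _ _ (1 + opnorm T0)) => // x; rewrite -(subrK (T0 x) (L x)).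
  by rewrite (le_trans (ler_normD _ _))// mulrDl lerD ?opnorm_apply// distrC.
apply/cvg_ex; exists (bop_of bL); apply/cvgrPdist_le => e e0.
have e2 : 0 < e / 2 by rewrite divr_gt0.
have [T FT] := cF _ e2; apply: filterS (FT) => S; rewrite -ball_normE /= => /ltW TS.
rewrite -(subrK T (bop_of bL)) -addrA (le_trans (ler_normD _ _))// [leRHS]splitr lerD//.
apply: opnorm_le => [|x]; first exact: ltW.
by rewrite -normrN opprB; exact: LT.
Qed.

HB.instance Definition _ := Uniform_isComplete.Build bop bop_complete.

Definition bop_mul S T : bop := bop_of (BH_comp (bop_BH S) (bop_BH T)).
Definition bop_star T : bop := bop_of (BH_adj (bop_BH T)).

Lemma bop_mulA : associative bop_mul.
Proof. by move=> S T U; exact: val_inj. Qed.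

Lemma bop_mul_linearl T : linear (bop_mul^~ T).
Proof. by move=> k S U; exact: val_inj. Qed.

Lemma bop_mul_linearr S : linear (bop_mul S).
Proof. by move=> k T U; apply/val_inj/funext => x; exact: BH_linear (bop_BH S) _ _ _. Qed.

Lemma bop_mul_norm S T : `|bop_mul S T| <= `|S| * `|T|.
Proof.
rewrite !bop_normE; apply: opnorm_le => [|x]; first by rewrite mulr_ge0 ?opnorm_ge0.
by rewrite (le_trans (opnorm_apply S (T x)))// -mulrA ler_wpM2l ?opnorm_ge0// opnorm_apply.
Qed.

Lemma bop_starK : involutive bop_star.
Proof. by move=> T; apply: val_inj; exact: adjK (bop_BH T). Qed.

Lemma bop_starP (k : C) S T :
  bop_star (k *: S + T) = k^* *: bop_star S + bop_star T.
Proof. by apply: val_inj; exact: adj_lincomb (bop_BH S) (bop_BH T). Qed.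

Lemma bop_starM S T : bop_star (bop_mul S T) = bop_mul (bop_star T) (bop_star S).
Proof. by apply: val_inj; exact: adj_comp (bop_BH S) (bop_BH T). Qed.

Lemma bop_star_norm_le T : `|bop_star T| <= `|T|.
Proof.
apply: opnorm_le => [|x]; first exact: opnorm_ge0.
by apply: (norm_adj_le x (bop_BH T) (opnorm_ge0 T)) => y; exact: opnorm_apply.
Qed.

Lemma bop_cstar_norm T : `|bop_mul (bop_star T) T| = `|T| ^+ 2.
Proof.
apply/le_anti/andP; split.
  by rewrite (le_trans (bop_mul_norm _ _))// expr2 ler_wpM2r// bop_star_norm_le.
set c := `|bop_mul _ _|; have c0 : 0 <= c by exact: normr_ge0.
(* The square root of [c] bounds [T], because [|T x|^2 = <<adj T (T x), x>> <= c * |x|^2]. *)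
rewrite -[leRHS]sqrtCK ler_sqr ?nnegrE ?sqrtC_ge0//.
apply: opnorm_le => [|x]; first by rewrite sqrtC_ge0.
rewrite -ler_sqr ?nnegrE ?mulr_ge0 ?sqrtC_ge0// exprMn sqrtCK.
rewrite -[leLHS]ger0_norm ?exprn_ge0// -inner_norm -(adjEl _ _ (bop_BH T)).
rewrite (le_trans (ip_CauchySchwarz _ _))// expr2 mulrA ler_wpM2r//.
exact: (opnorm_apply (bop_mul (bop_star T) T)).
Qed.

HB.instance Definition _ := isCStarAlgebra.Build R bop bop_mulA bop_mul_linearl
  bop_mul_linearr bop_mul_norm bop_starK bop_starP bop_starM bop_cstar_norm.

End BoundedOperatorAlgebra.

(** * Order properties of sums of nonnegative terms *)

Section NonnegativeSums.
Context {K : numFieldType} {I : choiceType} (f : I -> K) (l : K).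
Hypotheses (f_ge0 : forall i, 0 <= f i) (fl : has_sum (V := K^o) f l).

(** The partial sums equal their own norms, so the limit equals its norm. This also makes [l] real,
    which the comparisons below need since the order is partial. *)
Lemma has_sum_ge0 : 0 <= l.
Proof.
have nl : has_sum (V := K^o) f `|l|.
  rewrite /has_sum (_ : partial_sum f = fun A => `|partial_sum f A : K^o|).
    exact: (cvg_norm fl).
  by apply/funext => A; rewrite ger0_norm// partial_sumE sumr_ge0.
by rewrite (has_sum_unique fl nl).
Qed.

Let sum_real (A : {fset I}) : l - \sum_(i <- A) f i \is Num.real.
Proof. by rewrite realB// ger0_real ?has_sum_ge0// sumr_ge0. Qed.

Lemma has_sum_le (M : K) : (forall A : {fset I}, \sum_(i <- A) f i <= M) -> l <= M.
Proof.
move=> fM; apply/ler_addgt0Pr => e /((has_sumP (V := K^o) f l).1 fl)[A /(_ A (fsubset_refl _)) /ltW].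
move=> /(le_trans (real_ler_norm (sum_real A))); rewrite lerBlDl => /le_trans; apply.
by rewrite lerD2r.
Qed.

Lemma has_sum_ge (A : {fset I}) : \sum_(i <- A) f i <= l.
Proof.
apply/ler_addgt0Pr => e /((has_sumP (V := K^o) f l).1 fl)[B /(_ (A `|` B)%fset (fsubsetUr _ _)) /ltW].
rewrite distrC => /(le_trans (real_ler_norm _)); rewrite -opprB realN => /(_ (sum_real _)).
rewrite opprB lerBlDl; apply: le_trans.
by rewrite (big_fset_subset _ (fsubsetUl A B)) lerDl sumr_ge0.
Qed.

End NonnegativeSums.

(** * Normal endomorphisms of a direct sum of corners *)

Section DirectSumOfCorners.
Context {R : realType} {H : hilbertType R} {I : choiceType} (P : I -> H -> H).
Local Notation C := R[i].
Hypotheses (P_proj : forall i, projection (P i))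
  (P_orth : forall i j, i != j -> P i \o P j = 0).

Local Notation W := (vn_direct_sum (fun i => corner (P i))).

Lemma proj_idem p x : @projection R H p -> p (p x) = p x.
Proof. by case=> _ pp _; rewrite -[in RHS]pp. Qed.

Lemma proj_ip p x y : @projection R H p -> <<p x, y>> = <<x, p y>>.
Proof. by case=> bp _ sp; rewrite adjE// sp. Qed.

Lemma proj_ip_norm p x : @projection R H p -> <<p x, x>> = `|p x| ^+ 2.
Proof. by move=> pp; rewrite -inner_norm -proj_ip// proj_idem. Qed.

Lemma proj_norm_le p x : @projection R H p -> `|p x| <= `|x|.
Proof. by move=> pp; apply: ip_norm_le; exact: proj_ip_norm. Qed.

Lemma proj_orth i j x : i != j -> P i (P j x) = 0.
Proof. by move=> ij; have /(congr1 (fun f => f x)) := P_orth ij. Qed.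

(** [one] is the unit of the direct sum; it need not be the identity of [H]. *)
Lemma corners_unit : exists one : H -> H, [/\ projection one,
  (forall x, has_sum (fun i => P i x) (one x)),
  (forall i x, P i (one x) = P i x) & forall i x, one (P i x) = P i x].
Proof.
apply: sum_of_projections => [i x|i x y|i j x].
- exact: proj_idem.
- exact: proj_ip.
- exact: proj_orth.
Qed.

Variable one : H -> H.
Hypothesis one_sum : forall x, has_sum (fun i => P i x) (one x).

(** The component of [T] in the summand [i] must be [P i \o T], equal to [T \o P i]. This trades the
    family of components for commutation relations that are easy to check. *)
Lemma vn_direct_sumP T : W T <->
  [/\ BH T, forall i x, P i (T x) = T (P i x) & forall x, T (one x) = T x].
Proof.
split=> [[bT [t tW Tt]]|[bT PT T1]].
  have tE i : t i = P i \o t i \o P i.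
    have [S bS <-] := tW i; apply/funext => x /=.
    by rewrite !proj_idem.
  have Pt i j x : P i (t j x) = if i == j then t i x else 0.
    rewrite tE /=; case: eqVneq => [->|ij]; last exact: proj_orth.
    by rewrite proj_idem// [in RHS]tE.
  have tP i j x : t j (P i x) = if i == j then t i x else 0.
    case: eqVneq => [->|ij]; first by rewrite tE /= proj_idem// [in RHS]tE.
    have [S [lS _] <-] := tW j; rewrite /= proj_orth 1?eq_sym// linear0f//.
    by rewrite linear0f//; exact: projection_linear.
  have Pi_T i x : P i (T x) = t i x.
    have [bPi _ _] := P_proj i.
    apply: has_sum_unique (BH_has_sum bPi (Tt x)) _.
    have := @has_sum1 _ _ _ i (fun j => P i (t j x)); rewrite Pt eqxx; apply=> j ji.
    by rewrite Pt eq_sym (negbTE ji).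
  have TPi i x : T (P i x) = t i x.
    apply: has_sum_unique (Tt (P i x)) _.
    have := @has_sum1 _ _ _ i (fun j => t j (P i x)); rewrite tP eqxx; apply=> j ji.
    by rewrite tP eq_sym (negbTE ji).
  split=> // [i x|x]; first by rewrite Pi_T TPi.
  apply: has_sum_unique (BH_has_sum bT (@one_sum x)) _.
  by apply: eq_has_sum (Tt x) => i; rewrite TPi.
split=> //; exists (fun i => P i \o T \o P i) => [i|x]; first by exists T.
rewrite -T1; apply: eq_has_sum (BH_has_sum bT (@one_sum x)) => i /=.
by rewrite PT proj_idem.
Qed.

End DirectSumOfCorners.

(** * Partial isometries implementing a normal endomorphism *)

Section IntertwiningIsometries.
Context {R : realType} {H : hilbertType R} {I : choiceType} (P : I -> H -> H).
Local Notation C := R[i].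
Local Notation W := (vn_direct_sum (fun i => corner (P i))).
Variables (one : H -> H) (alpha : (H -> H) -> H -> H) (xi : I -> H).
Hypotheses (P_proj : forall i, projection (P i))
  (P_orth : forall i j, i != j -> P i \o P j = 0)
  (one_proj : projection one)
  (one_sum : forall x, has_sum (fun i => P i x) (one x))
  (P_one : forall i x, P i (one x) = P i x)
  (one_P : forall i x, one (P i x) = P i x)
  (alpha_end : star_endomorphism W alpha)
  (alpha_normal : normal_map W alpha)
  (xi_norm : forall i, `|xi i| = 1)
  (P_xi : forall i, P i (xi i) = xi i).

Let WP := vn_direct_sumP P_proj P_orth one_sum.

Lemma W_BH w : W w -> BH w. Proof. by case. Qed.

Lemma W_lincomb k S T : W S -> W T -> W (k *: S + T).
Proof.
move=> /WP[bS PS S1] /WP[bT PT T1]; apply/WP; split=> [|i x|x].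
- exact: BH_lincomb.
- by rewrite !fctE linearDf ?linearZf ?PS ?PT//; exact: projection_linear.
- by rewrite !fctE S1 T1.
Qed.

Lemma W_zero : W 0.
Proof.
apply/WP; split=> [|i x|x]//; first exact: BH_zero.
by rewrite [LHS]linear0f//; exact: projection_linear.
Qed.

Lemma W_one : W one.
Proof.
apply/WP; split=> [|i x|x]; first by case: one_proj.
- by rewrite P_one one_P.
- exact: proj_idem.
Qed.

Lemma W_rank1 i x y : P i x = x -> P i y = y -> W (rank1 x y).
Proof.
move=> Px Py; apply/WP; split=> [|j z|z]; first exact: BH_rank1.
- rewrite /rank1 linearZf; last exact: projection_linear.
  rewrite proj_ip//; have [->|ji] := eqVneq j i; first by rewrite Px Py.
  by rewrite -Px -Py !(proj_orth P_orth _ ji) ip0r scaler0 scale0r.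
- by rewrite /rank1 proj_ip// -Py one_P.
Qed.

Let alphaW w : W w -> W (alpha w). Proof. by case: alpha_end => h _ _ _; exact: h. Qed.

Let alphaP k S T : W S -> W T -> alpha (k *: S + T) = k *: alpha S + alpha T.
Proof. by case: alpha_end => _ h _ _; exact: h. Qed.

Let alphaM S T : W S -> W T -> alpha (S \o T) = alpha S \o alpha T.
Proof. by case: alpha_end => _ _ h _; exact: h. Qed.

Let alpha_adj T : W T -> alpha (adj T) = adj (alpha T).
Proof. by case: alpha_end => _ _ _ h; exact: h. Qed.

Let alphaBH w : W w -> BH (alpha w). Proof. by move=> /alphaW/W_BH. Qed.

Lemma alpha_zero : alpha 0 = 0.
Proof.
have := alphaP (- 1) W_zero W_zero.
by rewrite scaler0 add0r scaleN1r addNr.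
Qed.

Lemma alphaZ k T : W T -> alpha (k *: T) = k *: alpha T.
Proof. by move=> WT; have := alphaP k WT W_zero; rewrite alpha_zero !addr0. Qed.

(** Moving the first operator across turns the pair into [alpha] of [rank1 y x \o rank1 z w], which
    is [<<z, x>> *: rank1 y w]. *)
Lemma alpha_rank1_ip i x y z w b c : P i x = x -> P i y = y -> P i z = z -> P i w = w ->
  <<alpha (rank1 x y) b, alpha (rank1 z w) c>> = <<x, z>> * <<b, alpha (rank1 y w) c>>.
Proof.
move=> Px Py Pz Pw; have W1 := W_rank1 Px Py; have W2 := W_rank1 Pz Pw.
have W3 := W_rank1 Py Px; rewrite adjE; last exact: alphaBH.
rewrite -alpha_adj// adj_rank1.
have := alphaM W3 W2 => /(congr1 (fun f => f c)) /= <-.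
rewrite (_ : rank1 y x \o rank1 z w = <<z, x>> *: rank1 y w).
  by rewrite alphaZ; [rewrite fctE ipZr -ipC|exact: W_rank1 Py Pw].
by apply/funext => u; rewrite !fctE /= /rank1 ipZl scalerA mulrC.
Qed.

(** The same product now vanishes, because [x] and [z] lie in orthogonal corners. *)
Lemma alpha_rank1_orth i j x y z w b c : i != j ->
  P i x = x -> P i y = y -> P j z = z -> P j w = w ->
  <<alpha (rank1 x y) b, alpha (rank1 z w) c>> = 0.
Proof.
move=> ij Px Py Pz Pw; have W1 := W_rank1 Px Py; have W2 := W_rank1 Pz Pw.
have W3 := W_rank1 Py Px; rewrite adjE; last exact: alphaBH.
rewrite -alpha_adj// adj_rank1.
have := alphaM W3 W2 => /(congr1 (fun f => f c)) /= <-.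
rewrite (_ : rank1 y x \o rank1 z w = 0) ?alpha_zero ?ip0r//.
apply/funext => u; rewrite /= /rank1 ipZl -Px -Pz -proj_ip//.
by rewrite (proj_orth P_orth _ ij) ip0l mulr0 scale0r.
Qed.

Lemma alpha_P w i x : W w -> P i (alpha w x) = alpha w (P i x).
Proof. by move=> /alphaW/WP[]. Qed.

Lemma one_alpha w x : W w -> one (alpha w x) = alpha w x.
Proof.
move=> /alphaW/WP[bw Pw w1]; apply: has_sum_unique (@one_sum _) _.
by rewrite -[X in has_sum _ X]w1; apply: eq_has_sum (BH_has_sum bw (@one_sum x)) => i; rewrite Pw.
Qed.

Lemma one_neq0 z : one z = z -> z != 0 -> exists i, P i z != 0.
Proof.
move=> oz /eqP z0; apply: contrapT => /forallNP Pz; apply: z0; rewrite -oz.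
apply: has_sum_unique (@one_sum z) _.
have := @has_sum_finite _ _ _ fset0 (fun i => P i z); rewrite big_seq_fset0; apply=> i _.
by have /negP := Pz i; rewrite negbK => /eqP.
Qed.

(** Each basis vector lies in a single corner, so its rank-one projection is in [W]. A nonzero
    remainder [one x - q x] has a nonzero component in some corner, again orthogonal to [B], against
    maximality. *)
Lemma corner_basis : exists B : set H, [/\ orthonormal_set B,
  (forall b, B b -> exists i, P i b = b)
  & forall x, has_sum (fun b : set_type B => rank1 (val b) (val b) x) (one x)].
Proof.
have [B [BG oB maxB]] := @maximal_orthonormal _ H
  [set g | `|g| = 1 /\ exists i, P i g = g] (fun g => @proj1 _ _).
have PB b : B b -> exists i, P i b = b by move=> /BG[].
have [q [pq qE qb]] := orthonormal_rank1 oB; exists B; split=> // x.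
rewrite -[X in has_sum _ X](_ : q x = one x)//; apply/esym/eqP; rewrite -subr_eq0.
have oneB b : B b -> one b = b by move=> /PB[i <-].
have oq : one (q x) = q x.
  have [bone _ _] := one_proj; apply: has_sum_unique (BH_has_sum bone (qE x)) _.
  apply: eq_has_sum (qE x) => b; rewrite /rank1 linearZf; last exact: projection_linear.
  by rewrite oneB//; exact: (set_valP b).
apply: contrapT => /negP z0; have [] := one_neq0 _ z0.
  by rewrite linearBf ?oq ?proj_idem//; exact: projection_linear.
set z := one x - q x in z0 *; move=> i Pz0.
apply: (maxB (`|P i z|^-1 *: P i z)); first split; first exact: normfZV.
  by exists i; rewrite linearZf ?proj_idem//; exact: projection_linear.
move=> b Bb; have [j Pjb] := PB b Bb; rewrite ipZl proj_ip// -Pjb.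
have [->|ij] := eqVneq i j; last by rewrite (proj_orth P_orth)// ip0r mulr0.
by rewrite proj_idem// Pjb ipBl qb// proj_ip// oneB// subrr mulr0.
Qed.

Lemma alpha_sum J (r : seq J) (T : J -> H -> H) : (forall j, W (T j)) ->
  W (\sum_(j <- r) T j) /\ alpha (\sum_(j <- r) T j) = \sum_(j <- r) alpha (T j).
Proof.
move=> WT; elim: r => [|j r [Wr alphar]].
  by rewrite !big_nil; split; [exact: W_zero|exact: alpha_zero].
rewrite !big_cons -alphar -[T j]scale1r; split; first exact: W_lincomb.
by rewrite alphaP// !scale1r.
Qed.

Lemma alpha_projection p : W p -> projection p -> projection (alpha p).
Proof.
move=> Wp [_ pp sp]; split; first exact: alphaBH.
- by rewrite -alphaM// pp.
- by rewrite -alpha_adj// sp.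
Qed.

Definition min_proj i := rank1 (xi i) (xi i).

Let unit_edges : set H := [set b | `|b| = 1 /\
  exists i j, alpha (min_proj i) b = b /\ P j b = b].

Lemma edge_set_exists : exists (B : set H) (src rng : set_type B -> I),
  [/\ orthonormal_set B,
    (forall b, alpha (min_proj (src b)) (val b) = val b),
    (forall b, P (rng b) (val b) = val b)
  & forall g i j, `|g| = 1 -> alpha (min_proj i) g = g -> P j g = g ->
      (forall b : set_type B, <<g, val b>> = 0) -> False].
Proof.
have [B [BG oB maxB]] := @maximal_orthonormal _ H unit_edges (fun g => @proj1 _ _).
have /choice[ij ijE] : forall b : set_type B, exists ij : I * I,
    alpha (min_proj ij.1) (val b) = val b /\ P ij.2 (val b) = val b.
  by move=> b; have [_ [i [j bE]]] := BG _ (set_valP b); exists (i, j).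
exists B, (fun b => (ij b).1), (fun b => (ij b).2); split=> // [b|b|g i j g1 ag Pg gB].
- by have [] := ijE b.
- by have [] := ijE b.
- apply: (maxB g); first by split=> //; exists i, j.
  by move=> b Bb; have := gB (SigSub (mem_set Bb)).
Qed.

Variables (B : set H) (src rng : set_type B -> I).
Hypotheses (B_on : orthonormal_set B)
  (alpha_src : forall b, alpha (min_proj (src b)) (val b) = val b)
  (P_rng : forall b, P (rng b) (val b) = val b)
  (B_max : forall g i j, `|g| = 1 -> alpha (min_proj i) g = g -> P j g = g ->
      (forall b : set_type B, <<g, val b>> = 0) -> False).

(** Applying [P (src b)] first keeps the rank-one operator in [W] for every [x], where [alpha] is
    controlled. *)
Definition edge_op (b : set_type B) : H -> H :=
  fun x => alpha (rank1 (P (src b) x) (xi (src b))) (val b).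
Local Notation S := edge_op.

Let PPi i x : P i (P i x) = P i x. Proof. exact: proj_idem. Qed.

Let B_orth (b c : set_type B) : b != c -> <<val b, val c>> = 0.
Proof. by move=> bc; apply: B_on.2 => //; exact: set_valP. Qed.

(** Different sources give 0 by orthogonality of corners. For equal sources the inner product
    reduces to that of [b] with [alpha (min_proj (src b)) c], and this projection fixes [c]. *)
Lemma edge_op_ip b c x y : <<S b x, S c y>> = if b == c then <<P (src b) x, y>> else 0.
Proof.
rewrite /S; have [e|ne] := eqVneq (src b) (src c); last first.
  rewrite (alpha_rank1_orth _ _ ne)//; case: eqP => // bc; by rewrite bc eqxx in ne.
have aq : alpha (rank1 (xi (src b)) (xi (src b))) (val c) = val c.
  by rewrite e; exact: alpha_src.
rewrite -e (@alpha_rank1_ip (src b))// aq.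
case: eqVneq => [<-|bc]; last by rewrite B_orth// mulr0.
by rewrite inner_norm B_on.1 ?expr1n ?mulr1 -?proj_ip ?PPi//; exact: (set_valP b).
Qed.

Lemma edge_op_BH b : BH (S b).
Proof.
apply: (@bounded_BH _ _ _ 1) => [k x y|x].
  rewrite /S (_ : rank1 _ _ = k *: rank1 (P (src b) x) (xi (src b)) +
      rank1 (P (src b) y) (xi (src b))).
    by rewrite alphaP//; exact: (@W_rank1 (src b)).
  apply/funext => z; have lP := projection_linear (P_proj (src b)).
  transitivity (<<z, xi (src b)>> *: (k *: P (src b) x + P (src b) y)).
    by rewrite -lP.
  by rewrite scalerDr !scalerA mulrC -scalerA.
rewrite mul1r -ler_sqr ?nnegrE// -inner_norm edge_op_ip eqxx proj_ip_norm//.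
by rewrite ler_sqr ?nnegrE// proj_norm_le.
Qed.

Lemma edge_op_src b x : S b (P (src b) x) = S b x.
Proof. by rewrite /S PPi. Qed.

Lemma edge_op_rng b x : P (rng b) (S b x) = S b x.
Proof. by rewrite /S alpha_P ?P_rng//; exact: (@W_rank1 (src b)). Qed.

(** Since [w] commutes with [P (src b)], composing [w] with the rank-one operator of [x] gives that
    of [w x]; then [alpha] is multiplicative. *)
Lemma edge_op_intertwines b w x : W w -> alpha w (S b x) = S b (w x).
Proof.
move=> Ww; have [bw Pw _] := (WP w).1 Ww; rewrite /S Pw.
have W1 : W (rank1 (P (src b) x) (xi (src b))) by exact: (@W_rank1 (src b)).
have := alphaM Ww W1 => /(congr1 (fun f => f (val b))) /= <-; congr (alpha _ _).
by apply/funext => z; rewrite /= /rank1 linearZf//; exact: BH_linear bw.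
Qed.

Lemma adj_edge_op b c x : adj (S b) (S c x) = if b == c then P (src b) x else 0.
Proof.
apply: ip_extr => y; rewrite -adjE ?edge_op_ip; last exact: edge_op_BH.
by case: ifP => _; rewrite ?ip0r// proj_ip.
Qed.

Lemma edge_range_projection : exists Q : H -> H, [/\ projection Q,
    (forall x, has_sum (fun b => S b (adj (S b) x)) (Q x))
  & forall b x, S b (adj (S b) (Q x)) = S b (adj (S b) x)].
Proof.
have [] := @sum_of_projections _ H (set_type B) (fun b x => S b (adj (S b) x)).
- by move=> b x; rewrite adj_edge_op eqxx edge_op_src.
- by move=> b x y; rewrite adjE ?adjEl//; exact: edge_op_BH.
- move=> b c x bc; rewrite adj_edge_op (negbTE bc) linear0f//.
  exact: BH_linear (edge_op_BH b).
by move=> Q [pQ QE SQ _]; exists Q.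
Qed.

Variable Q : H -> H.
Hypotheses (Q_proj : projection Q)
  (Q_sum : forall x, has_sum (fun b => S b (adj (S b) x)) (Q x))
  (S_Q : forall b x, S b (adj (S b) (Q x)) = S b (adj (S b) x)).

Lemma adj_edge_op_P b i x :
  adj (S b) (P i x) = if i == rng b then adj (S b) x else 0.
Proof.
apply: ip_extr => y; rewrite -adjE -?proj_ip//; last exact: edge_op_BH.
rewrite -edge_op_rng; case: eqVneq => [->|ib].
  by rewrite PPi edge_op_rng adjE//; exact: edge_op_BH.
by rewrite (proj_orth P_orth)// ip0l ip0r.
Qed.

(** Normality makes [alpha one] least among upper bounds lying in [W], so [Q] can compete only once
    it is known to be there. Each [S b] has its range in one corner, whence [Q] commutes with every
    [P i]. *)
Lemma W_range_projection : W Q.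
Proof.
apply/WP; split=> [|i x|x]; first by case: Q_proj.
- have [bP _ _] := P_proj i.
  apply: has_sum_unique (BH_has_sum bP (@Q_sum x)) _.
  apply: eq_has_sum (@Q_sum (P i x)) => b; rewrite adj_edge_op_P -[in RHS]edge_op_rng.
  case: eqVneq => [->|ib]; first by rewrite PPi edge_op_rng.
  by rewrite (proj_orth P_orth)// linear0f//; exact: BH_linear (edge_op_BH b).
- apply: has_sum_unique (@Q_sum _) _; apply: eq_has_sum (@Q_sum x) => b; congr (S b _).
  apply: ip_extr => y; rewrite -!adjE; try exact: edge_op_BH.
  by rewrite -edge_op_rng -[in RHS]proj_ip// one_P.
Qed.

(* Otherwise a component [P j y] of [y = alpha |xi i><eta| z], once normalized,
   could be added to [B]. *)
Lemma alpha_rank1_ker i eta z : P i eta = eta -> (forall b, adj (S b) z = 0) ->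
  alpha (rank1 eta eta) z = 0.
Proof.
move=> Pe Sz; pose y := alpha (rank1 (xi i) eta) z.
have norm_y : `|alpha (rank1 eta eta) z| ^+ 2 = `|eta| ^+ 2 * `|y| ^+ 2.
  rewrite -!inner_norm !(@alpha_rank1_ip i)// [<<xi i, _>>]inner_norm xi_norm.
  by rewrite expr1n mul1r.
suff y0 : y = 0.
  by apply/eqP; rewrite -normr_eq0 -sqrf_eq0 norm_y y0 normr0 expr0n/= mulr0.
apply/eqP; apply: contrapT => /negP y_neq0.
have W1 : W (rank1 (xi i) eta) by exact: (@W_rank1 i).
have W2 : W (min_proj i) by exact: (@W_rank1 i).
have [j Pjy] := one_neq0 (one_alpha z W1) y_neq0.
have qy : alpha (min_proj i) y = y.
  have := alphaM W2 W1 => /(congr1 (fun f => f z)) /= <-; congr (alpha _ _).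
  apply/funext => u; rewrite /min_proj /= /rank1 ipZl inner_norm xi_norm.
  by rewrite expr1n mulr1.
apply: (@B_max (`|P j y|^-1 *: P j y) i j); first exact: normfZV.
- by rewrite linearZf -?alpha_P ?qy//; exact: BH_linear (alphaBH W2).
- by rewrite linearZf ?PPi//; exact: projection_linear.
move=> b; rewrite ipZl proj_ip// -P_rng; case: (eqVneq j (rng b)) => [->|jb]; last first.
  by rewrite (proj_orth P_orth)// ip0r mulr0.
(* Writing [val b] as its image under [alpha (min_proj (src b))] reduces the inner product, when the
   sources agree, to one of [z] with [S b eta], zero by hypothesis on [z]. *)
rewrite PPi P_rng -alpha_src /y /min_proj; case: (eqVneq (src b) i) => [bi|bi]; last first.
  by rewrite (@alpha_rank1_orth i (src b)) ?mulr0// eq_sym.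
rewrite bi (@alpha_rank1_ip i)//.
have -> : alpha (rank1 eta (xi i)) (val b) = S b eta by rewrite /S bi Pe.
by rewrite -adjEl ?Sz ?ip0l ?mulr0//; exact: edge_op_BH.
Qed.

Lemma adj_edge_op_ker b x : adj (S b) (x - Q x) = 0.
Proof.
have bS := edge_op_BH b; have lA := BH_linear (BH_adj bS).
apply/eqP; rewrite -normr_eq0 -sqrf_eq0 -inner_norm adjEl//.
by rewrite linearBf// (linearBf (BH_linear bS)) S_Q subrr ip0r.
Qed.

(** The two quadratic forms are squared norms, and [|p x| = |p (q x)| <= |q x|]. *)
Lemma projection_le p q : @projection R H p -> projection q ->
  (forall x, p (q x) = p x) -> op_le p q.
Proof.
move=> pp pq pqE x; rewrite ipBl subr_ge0 !proj_ip_norm//.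
by rewrite ler_sqr ?nnegrE// -pqE proj_norm_le.
Qed.

(** * Approximation of the unit by finite-rank projections *)

Section FiniteRankApproximation.
Variables (B' : set H).
Hypotheses (B'_on : orthonormal_set B') (P_B' : forall b, B' b -> exists i, P i b = b)
  (one_B' : forall x, has_sum (fun b : set_type B' => rank1 (val b) (val b) x) (one x)).

Let fproj (F : {fset set_type B'}) : H -> H := \sum_(b <- F) rank1 (val b) (val b).

Let fprojE F x : fproj F x = \sum_(b <- F) rank1 (val b) (val b) x.
Proof. by rewrite /fproj fct_sumE. Qed.

Let W_basis (b : set_type B') : W (rank1 (val b) (val b)).
Proof. by have [i Pb] := P_B' (set_valP b); exact: (W_rank1 Pb Pb). Qed.

Let fproj_proj F : projection (fproj F).
Proof.
apply: projectionI => [x|x y]; last first.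
  by rewrite !fprojE ip_suml ip_sumr; apply: eq_bigr => b _; exact: rank1_ip.
rewrite [LHS]fprojE [RHS]fprojE big_seq [RHS]big_seq; apply: eq_bigr => b bF.
rewrite /rank1 fprojE ip_suml (big_fsetD1 b)//= big_seq big1 ?addr0.
  by rewrite /rank1 ipZl inner_norm B'_on.1 ?expr1n ?mulr1//; exact: (set_valP b).
move=> c; rewrite !inE => /andP[cb _]; rewrite /rank1 ipZl.
by rewrite (_ : <<val c, val b>> = 0) ?mulr0//; apply: B'_on.2 => //; exact: set_valP.
Qed.

Let fproj_ip F x : <<fproj F x, x>> = \sum_(b <- F) <<rank1 (val b) (val b) x, x>>.
Proof. by rewrite fprojE ip_suml. Qed.

Let rank1_ge0 (b : set_type B') x : 0 <= <<rank1 (val b) (val b) x, x>>.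
Proof. by rewrite /rank1 ipZl (ipC (val b)) -normCK exprn_ge0. Qed.

(** At each [x] the quadratic forms of the [fproj F] are the partial sums of a nonnegative series
    with sum [<<one x, x>>], so bounds transfer both ways. *)
Let fproj_lub : is_op_lub W (range fproj) one.
Proof.
split; first exact: W_one.
- by case: one_proj => bone _ sone.
- move=> _ [F _ <-] x; rewrite ipBl subr_ge0 fproj_ip.
  exact: (has_sum_ge (fun b => rank1_ge0 b x) (has_sum_ipl x (@one_B' x))).
- move=> T WT sT leT x; rewrite ipBl subr_ge0.
  apply: (has_sum_le (fun b => rank1_ge0 b x) (has_sum_ipl x (@one_B' x))) => F.
  rewrite -fproj_ip -subr_ge0 -ipBl; apply: leT; by exists F.
Qed.

(* The only use of normality. *)
Lemma alpha_one_le : op_le (alpha one) Q.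
Proof.
have WF F : W (fproj F) by exact: (alpha_sum F W_basis).1.
have [] := @alpha_normal (range fproj) one _ _ _ _ fproj_lub.
- by exists (fproj fset0), fset0.
- by move=> _ [F _ <-].
- by move=> _ [F _ <-]; split; [exact: W_BH|case: (fproj_proj F)].
- move=> _ _ [F1 _ <-] [F2 _ <-]; exists (fproj (F1 `|` F2)%fset).
  have le12 F F' : (F `<=` F')%fset -> op_le (fproj F) (fproj F').
    move=> FF' x; rewrite ipBl !fproj_ip (big_fset_subset _ FF') addrC addKr.
    exact: sumr_ge0.
  by split; [exists (F1 `|` F2)%fset|apply: le12; exact: fsubsetUl|
    apply: le12; exact: fsubsetUr].
move=> _ _ _ least; apply: least.
- exact: W_range_projection.
- by case: Q_proj.
(* Every rank-one summand of [fproj F] has an image under [alpha] that kills [x - Q x]; hence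
   [alpha (fproj F)] absorbs [Q] on the right and lies below it. *)
move=> _ [_ [F _ <-] <-]; apply: projection_le => // [|x].
  exact: alpha_projection.
apply/esym/eqP; rewrite -subr_eq0 -linearBf; last exact: BH_linear (alphaBH (WF F)).
rewrite (alpha_sum F W_basis).2 fct_sumE big1// => b _.
have [i Pb] := P_B' (set_valP b).
by apply: (alpha_rank1_ker Pb) => e; exact: adj_edge_op_ker.
Qed.

End FiniteRankApproximation.

(** Evaluate [alpha one <= Q] at [x - Q x], which [Q] kills: the squared norm of the left side is at
    most 0. *)
Lemma alpha_one_range x : alpha one (x - Q x) = 0.
Proof.
have [B' [oB' PB' oneB']] := corner_basis.
have := alpha_one_le oB' PB' oneB' (x - Q x).
rewrite (linearBf (projection_linear Q_proj)) proj_idem// subrr sub0r.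
have pa := alpha_projection W_one one_proj.
rewrite ipNl oppr_ge0 proj_ip_norm//.
by move=> le0; apply/eqP; rewrite -normr_eq0 -sqrf_eq0 eq_le le0 exprn_ge0.
Qed.

Lemma alpha_range w x : W w -> alpha w (Q x) = alpha w x.
Proof.
move=> Ww; have [_ _ w1] := (WP w).1 Ww.
have wE : w \o one = w by apply/funext => u /=.
apply/esym/eqP; rewrite -subr_eq0 -linearBf; last exact: BH_linear (alphaBH Ww).
rewrite -wE (alphaM Ww W_one) /= alpha_one_range linear0f//.
exact: BH_linear (alphaBH Ww).
Qed.

(** Replace [x] by [Q x], apply the bounded operator [alpha w] to the sum defining [Q x], and
    intertwine term by term. *)
Lemma alpha_decomposition w x : W w ->
  has_sum (fun b => (S b \o w \o adj (S b)) x) (alpha w x).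
Proof.
move=> Ww; rewrite -alpha_range//.
apply: eq_has_sum (BH_has_sum (alphaBH Ww) (@Q_sum x)) => b /=.
by rewrite edge_op_intertwines.
Qed.

End IntertwiningIsometries.

(** * Toeplitz representations *)

Section StrongSums.
Context {R : realType} {H : hilbertType R} {J : choiceType}.
Local Notation C := R[i].
Implicit Types (T : J -> H -> H) (U : bop H).

(* Junk value: 0 when the strong sum does not define a bounded operator. *)
Definition strong_sum T : bop H :=
  xget 0 [set U : bop H | forall h, has_sum (fun j => T j h) (U h)].

Lemma strong_sum_eq T U : (forall h, has_sum (fun j => T j h) (U h)) -> strong_sum T = U.
Proof.
move=> TU; apply: xget_unique => //= U' TU'; apply/val_inj/funext => h.
exact: has_sum_unique (TU' h) (TU h).
Qed.

Lemma strong_sumP T (M : C) : 0 <= M -> (forall j, linear (T j)) ->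
  (forall i j h, i != j -> <<T i h, T j h>> = 0) ->
  (forall (A : {fset J}) h, \sum_(j <- A) `|T j h| ^+ 2 <= M * `|h| ^+ 2) ->
  forall h, has_sum (fun j => T j h) (strong_sum T h).
Proof.
move=> M0 lT oT TM.
have /choice[U UE] : forall h, exists l, has_sum (fun j => T j h) l.
  by move=> h; apply: orthogonal_has_sum (TM ^~ h) => i j; exact: oT.
have lU : linear U.
  move=> k x y; apply: has_sum_unique (UE _) _.
  by apply: eq_has_sum (has_sum_lincomb k (UE x) (UE y)) => j; rewrite lT.
have bU : BH U.
  apply: (@bounded_BH _ _ _ (sqrtC M)) => // h; apply: has_sum_bounded (UE h) _ => A.
  rewrite -ler_sqr ?nnegrE ?mulr_ge0 ?sqrtC_ge0// exprMn sqrtCK.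
  rewrite (@pythagoras_sum _ _ _ _ (fun j => T j h)) ?fset_uniq ?TM//.
  by move=> i j _ _; exact: oT.
by rewrite (strong_sum_eq (U := bop_of bU)).
Qed.

End StrongSums.

(** * The Toeplitz representation defined by projections and partial isometries *)

Section ToeplitzFamily.
Context {R : realType} {H : hilbertType R} (E : graph).
Local Notation C := R[i].
Variables (P : vert E -> H -> H) (S : edge E -> H -> H) (one : H -> H).
Hypotheses (P_proj : forall v, projection (P v))
  (P_orth : forall v w, v != w -> P v \o P w = 0)
  (P_unit : forall v, exists h, `|h| = 1 /\ P v h = h)
  (one_proj : projection one)
  (one_sum : forall x, has_sum (fun v => P v x) (one x))
  (P_one : forall v x, P v (one x) = P v x)
  (S_BH : forall e, BH (S e))
  (S_ip : forall e f x y, <<S e x, S f y>> = if e == f then <<P (src e) x, y>> else 0)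
  (S_rng : forall e x, P (rng e) (S e x) = S e x).
Implicit Types (x y : edge E -> C) (a b : vert E -> C) (h k : H).

Definition toeplitz_pi a : bop H := strong_sum (fun v h => a v *: P v h).
Definition toeplitz_sigma x : bop H := strong_sum (fun e h => x e *: S e h).
Local Notation pi := toeplitz_pi.
Local Notation sigma := toeplitz_sigma.

(** Only finitely many values have modulus at least 1; one plus the sum of their moduli is a
    bound. *)
Lemma C0_bounded a : C0 a -> exists2 M : C, 0 <= M & forall v, `|a v| <= M.
Proof.
move=> /(_ 1 ltr01) fin; set A := [set v | _] in fin.
have s0 : 0 <= \sum_(v <- fset_set A) `|a v| by exact: sumr_ge0.
exists (1 + \sum_(v <- fset_set A) `|a v|); first by rewrite addr_ge0.
move=> v; have [av|/negP av] := pselect (1 <= `|a v|).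
  have vA : v \in fset_set A by rewrite in_fset_set// inE.
  by rewrite (big_fsetD1 v)//= addrCA lerDl addr_ge0// sumr_ge0.
by rewrite -real_ltNge// in av; rewrite (le_trans (ltW av))// lerDl.
Qed.

Lemma P_bessel (A : {fset vert E}) h : \sum_(v <- A) `|P v h| ^+ 2 <= `|h| ^+ 2.
Proof.
apply: (@le_trans _ _ <<one h, h>>); last first.
  by rewrite proj_ip_norm// ler_sqr ?nnegrE// proj_norm_le.
have := @has_sum_ge _ _ _ _ _ (has_sum_ipl h (@one_sum h)) A.
under eq_bigr do rewrite proj_ip_norm//.
by apply=> v; rewrite proj_ip_norm// exprn_ge0.
Qed.

Lemma pi_sum a : C0 a -> forall h, has_sum (fun v => a v *: P v h) (pi a h).
Proof.
move=> /C0_bounded[M M0 aM]; apply: (@strong_sumP _ _ _ _ (M ^+ 2)).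
- exact: exprn_ge0.
- move=> v c h k; rewrite (projection_linear (P_proj v)) scalerDr !scalerA.
  by rewrite (mulrC c).
- move=> v w h vw; rewrite ipZl ipZr proj_ip// (proj_orth P_orth)// ip0r.
  by rewrite !mulr0.
move=> A h; apply: (@le_trans _ _ (\sum_(v <- A) M ^+ 2 * `|P v h| ^+ 2)).
  apply: ler_sum => v _; rewrite normrZ exprMn ler_wpM2r ?exprn_ge0//.
  by rewrite ler_sqr ?nnegrE.
by rewrite -mulr_sumr ler_wpM2l ?exprn_ge0// P_bessel.
Qed.

Arguments pi_sum {a} _ h.

Lemma S_src e h : S e (P (src e) h) = S e h.
Proof.
apply/eqP; rewrite -subr_eq0 -linearBf; last exact: BH_linear (S_BH e).
rewrite -normr_eq0 -sqrf_eq0 -inner_norm S_ip eqxx linearBf ?proj_idem ?subrr ?ip0l//.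
exact: projection_linear.
Qed.

Lemma norm_S e h : `|S e h| ^+ 2 = `|P (src e) h| ^+ 2.
Proof. by rewrite -inner_norm S_ip eqxx proj_ip_norm. Qed.

(** Grouping edges by source, the coefficients at a vertex [v] contribute at most [xhat v], which is
    bounded by [M]; Bessel's inequality for the [P v] then bounds the whole by [M * |h|^2]. *)
Lemma sigma_sum x : XE x -> forall h, has_sum (fun e => x e *: S e h) (sigma x h).
Proof.
move=> [xhat /C0_bounded[M M0 xM] xhatE]; apply: (@strong_sumP _ _ _ _ M) => //.
- move=> e c h k; rewrite (BH_linear (S_BH e)) scalerDr !scalerA.
  by rewrite (mulrC c).
- by move=> e f h ef; rewrite ipZl ipZr S_ip (negbTE ef) !mulr0.
move=> A h; pose V := [fset src e | e in A]%fset.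
have -> : \sum_(e <- A) `|x e *: S e h| ^+ 2 =
    \sum_(v <- V) \sum_(e <- A) (if src e == v then `|x e| ^+ 2 else 0) * `|P v h| ^+ 2.
  rewrite exchange_big /= big_seq [RHS]big_seq; apply: eq_bigr => e eA.
  have sV : src e \in V by apply/imfsetP; exists e.
  rewrite (big_fsetD1 (src e))//= eqxx big_seq big1 ?addr0 => [|v].
    by rewrite normrZ exprMn norm_S.
  by rewrite !inE eq_sym => /andP[/negbTE -> _]; rewrite mul0r.
apply: (@le_trans _ _ (\sum_(v <- V) M * `|P v h| ^+ 2)); last first.
  by rewrite -mulr_sumr ler_wpM2l// P_bessel.
apply: ler_sum => v _; rewrite -mulr_suml ler_wpM2r ?exprn_ge0//.
have ge0 e : 0 <= (if src e == v then `|x e| ^+ 2 else 0) by case: ifP => // _; rewrite exprn_ge0.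
apply: (le_trans (has_sum_ge ge0 (xhatE v) A)); rewrite (le_trans _ (xM v))//.
by rewrite ger0_norm// (has_sum_ge0 ge0 (xhatE v)).
Qed.

Arguments sigma_sum {x} _ h.

Lemma P_pi a v h : C0 a -> P v (pi a h) = a v *: P v h.
Proof.
move=> a0; have [bP _ _] := P_proj v; have lP := BH_linear bP.
apply: has_sum_unique (BH_has_sum bP (pi_sum a0 h)) _.
have := @has_sum1 _ _ _ v (fun w => P v (a w *: P w h)).
rewrite linearZf// proj_idem//; apply=> w wv.
by rewrite linearZf// (proj_orth P_orth) ?scaler0// eq_sym.
Qed.

Lemma pi_P a v h : C0 a -> pi a (P v h) = a v *: P v h.
Proof.
move=> a0; apply: has_sum_unique (pi_sum a0 (P v h)) _.
have := @has_sum1 _ _ _ v (fun w => a w *: P w (P v h)).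
by rewrite proj_idem//; apply=> w wv; rewrite (proj_orth P_orth)// scaler0.
Qed.

Lemma one_pi a h : C0 a -> one (pi a h) = pi a h.
Proof.
move=> a0; apply: has_sum_unique (@one_sum (pi a h)) _.
by apply: eq_has_sum (pi_sum a0 h) => v; rewrite P_pi.
Qed.

Lemma pi_conj a : C0 a -> pi (fun v => (a v)^*) = bop_star (pi a).
Proof.
move=> a0; apply: strong_sum_eq => h.
have bU := bop_BH (pi a).
(* The range of [pi a] lies under [one], so its adjoint sees only [one h], which can be expanded
   over the vertices. *)
have -> : bop_star (pi a) h = adj (pi a) (one h).
  by apply: ip_ext => k; rewrite /= !adjEl// proj_ip// one_pi.
apply: eq_has_sum (BH_has_sum (BH_adj bU) (@one_sum h)) => v.
apply: ip_ext => k; rewrite adjEl// proj_ip// P_pi// ipZr ipZl.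
by rewrite proj_ip.
Qed.

Lemma S_sigma_ip x e h k : XE x -> <<S e h, sigma x k>> = (x e)^* * <<P (src e) h, k>>.
Proof.
move=> x0; apply: (has_sum_unique (V := C^o)) (has_sum_ipr (S e h) (sigma_sum x0 k)) _.
have := @has_sum1 _ C^o _ e (fun f => <<S e h, x f *: S f k>>).
rewrite ipZr S_ip eqxx; apply=> f fe.
by rewrite ipZr S_ip eq_sym (negbTE fe) mulr0.
Qed.

(** Both the convergence of [X_inner] and its compatibility with [sigma] are read off this expansion
    of [sigma y]. *)
Lemma X_inner_sum x y v h k : XE x -> XE y ->
  has_sum (V := C^o)
    (fun e => (if src e == v then (x e)^* * y e else 0) * <<P v h, k>>)
    <<sigma y (P v h), sigma x k>>.
Proof.
move=> x0 y0.
apply: (eq_has_sum (V := C^o)) (has_sum_ipl (sigma x k) (sigma_sum y0 (P v h))) => e.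
rewrite ipZl S_sigma_ip//; case: eqVneq => [->|ev].
  by rewrite proj_idem// mulrA (mulrC (y e)).
by rewrite (proj_orth P_orth)// ip0l mulr0 mulr0 mul0r.
Qed.

Arguments X_inner_sum {x y} v h k _ _.

(* [X_inner] is a bare limit; it exists because, at a unit vector [u] of the
   range of [P v], its partial sums are those of the convergent sum for
   [<<sigma y u, sigma x u>>]. *)
Lemma X_innerE x y v : XE x -> XE y ->
  has_sum (V := C^o) (fun e => if src e == v then (x e)^* * y e else 0) (X_inner x y v).
Proof.
move=> x0 y0; have [u [u1 Pu]] := P_unit v.
have := X_inner_sum v u u x0 y0; rewrite Pu inner_norm u1 expr1n.
move=> /(eq_has_sum (V := C^o) (fun e => mulr1 _)) xy.
by rewrite /X_inner /summability.sum (norm_cvg_lim (V := C^o) xy).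
Qed.

(* Comparing both sides on each [P v H] avoids regrouping a double sum. *)
Lemma pi_X_inner x y : XE x -> XE y ->
  pi (X_inner x y) = bop_mul (bop_star (sigma x)) (sigma y).
Proof.
move=> x0 y0; apply: strong_sum_eq => h; set L := bop_mul _ _.
have Lh : L (one h) = L h.
  rewrite /= (_ : sigma y (one h) = sigma y h)//.
  apply: has_sum_unique (sigma_sum y0 _) _; apply: eq_has_sum (sigma_sum y0 h) => e.
  by rewrite -[in RHS]S_src P_one S_src.
rewrite -Lh; apply: eq_has_sum (BH_has_sum (bop_BH L) (@one_sum h)) => v.
apply: ip_ext => k; rewrite /= adjEl; last exact: bop_BH.
apply: (has_sum_unique (V := C^o)) (X_inner_sum v h k x0 y0) _.
rewrite ipZl; apply: (has_sum_map (V := C^o) (T := fun c : C^o => c * <<P v h, k>> : C^o)).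
- by move=> c d; exact: mulrDl.
- exact: mulrr_continuous.
- exact: X_innerE.
Qed.

(** Strong sums are unique, so each relation reduces to an identity between terms. *)
Lemma toeplitz_family_rep : toeplitz_rep (B := bop H) sigma pi.
Proof.
split.
- move=> k x y x0 y0; apply: strong_sum_eq => h.
  apply: eq_has_sum (has_sum_lincomb k (sigma_sum x0 h) (sigma_sum y0 h)) => e.
  by rewrite scalerA -scalerDl.
- split.
  + move=> k a b a0 b0; apply: strong_sum_eq => h.
    apply: eq_has_sum (has_sum_lincomb k (pi_sum a0 h) (pi_sum b0 h)) => v.
    by rewrite scalerA -scalerDl.
  + move=> a b a0 b0; apply: strong_sum_eq => h.
    apply: eq_has_sum (pi_sum a0 (pi b h)) => v.
    by rewrite P_pi// scalerA.
  + by move=> a a0; exact: pi_conj.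
- move=> x a x0 a0; apply: strong_sum_eq => h.
  apply: eq_has_sum (sigma_sum x0 (pi a h)) => e.
  rewrite -S_src P_pi// linearZf ?S_src ?scalerA//; exact: BH_linear (S_BH e).
- move=> x a x0 a0; apply: strong_sum_eq => h.
  apply: eq_has_sum (BH_has_sum (bop_BH (pi a)) (sigma_sum x0 h)) => e.
  rewrite linearZf; last exact: BH_linear (bop_BH _).
  by rewrite -S_rng pi_P// S_rng scalerA mulrC.
- by move=> x y x0 y0; exact: pi_X_inner.
Qed.

Lemma XE_delta_edge (e : edge E) : XE (delta_edge R e).
Proof.
exists (fun v => (src e == v)%:R) => [eps eps0|v].
  apply: (sub_finite_set _ (finite_set1 (src e))) => v /=.
  case: eqVneq => [->//|_]; rewrite normr0 => /(lt_le_trans eps0).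
  by rewrite ltxx.
have := @has_sum1 _ C^o _ e
  (fun f => if src f == v then `|delta_edge R e f| ^+ 2 else 0).
rewrite /delta_edge eqxx normr1 expr1n.
have -> : (if src e == v then 1 else 0) = (src e == v)%:R :> C by case: ifP.
by apply=> f /negbTE ->; rewrite normr0 expr0n; case: ifP.
Qed.

Lemma sigma_delta_edge (e : edge E) h : sigma (delta_edge R e) h = S e h.
Proof.
rewrite (_ : sigma _ = bop_of (S_BH e))//; apply: strong_sum_eq => k.
have := @has_sum1 _ _ _ e (fun f => delta_edge R e f *: S f k).
rewrite (_ : delta_edge R e e = 1) ?scale1r; last by rewrite /delta_edge eqxx.
by apply=> f /negbTE; rewrite /delta_edge => ->; rewrite scale0r.
Qed.

End ToeplitzFamily.

(** * Countability of the edge set over a separable space *)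

Section Countability.
Context {R : realType} {H : hilbertType R}.

Lemma orthonormal_dist (B : set H) b c : orthonormal_set B -> B b -> B c -> b != c ->
  1 <= `|b - c|.
Proof.
move=> [B1 oB] Bb Bc bc.
have e1 : <<b - c, b>> = 1.
  by rewrite ipBl inner_norm B1// expr1n [<<c, b>>]oB ?subr0// eq_sym.
by have := ip_CauchySchwarz (b - c) b; rewrite e1 normr1 (B1 _ Bb) mulr1.
Qed.

(** Choose a point of the countable dense set within 1/2 of each vector. Distinct vectors are at
    distance at least 1, so the choice is injective. *)
Lemma orthonormal_countable (B : set H) : separable H -> orthonormal_set B ->
  countable [set: set_type B].
Proof.
move=> [D /countable_injP[g g_inj] dD] oB.
have /choice[f fP] : forall b : set_type B, exists d, D d /\ `|val b - d| < 2^-1.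
  move=> b; have [||d [bd Dd]] := dD (ball (val b) (2^-1 : R[i])).
  - by exists (val b); apply: ballxx; rewrite invr_gt0.
  - by apply: ball_open; rewrite invr_gt0.
  - by exists d; split=> //; move: bd; rewrite -ball_normE.
apply/countable_injP; exists (g \o f) => b c _ _ /= gbc.
have fbc : f b = f c by apply: g_inj => //; rewrite inE; [have [] := fP b|have [] := fP c].
apply/eqP; apply: contraT => bc.
have := orthonormal_dist oB (set_valP b) (set_valP c) bc.
suff lt1 : `|val b - val c| < 1 by move=> /(lt_le_trans lt1); rewrite ltxx.
rewrite -(subrK (f b) (val b)) -addrA (le_lt_trans (ler_normD _ _))// [ltRHS]splitr div1r.
by rewrite ltrD ?(fP b).2// fbc distrC (fP c).2.
Qed.

End Countability.

(** The unit of the factor is nonzero and has the form [P \o S \o P], so [P] is nonzero; normalize a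
    vector of its range. *)
Lemma corner_unit_vector (R : realType) (H : hilbertType R) (P : H -> H) :
  projection P -> type_I_factor (corner P) -> exists x, `|x| = 1 /\ P x = x.
Proof.
move=> pP [_ [p [[cp _] p0 _ _ _]]]; have lP := projection_linear pP.
have [x Px0] : exists x, P x != 0.
  apply: contrapT => /forallNP PE; apply: p0; apply/funext => x.
  by have [S _ <-] := cp; have /negP := PE (S (P x)); rewrite negbK => /eqP.
exists (`|P x|^-1 *: P x); rewrite linearZf// proj_idem//; split=> //.
exact: normfZV.
Qed.

Lemma intertwining_isometries (R : realType) (H : hilbertType R) (I : choiceType)
    (P : I -> H -> H) (one : H -> H) (alpha : (H -> H) -> H -> H) :
  let W := vn_direct_sum (fun i => corner (P i)) in
  (forall i, projection (P i)) ->
  (forall i j, i != j -> P i \o P j = 0) ->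
  (forall i, exists x, `|x| = 1 /\ P i x = x) ->
  projection one ->
  (forall x, has_sum (fun i => P i x) (one x)) ->
  (forall i x, P i (one x) = P i x) ->
  (forall i x, one (P i x) = P i x) ->
  star_endomorphism W alpha -> normal_map W alpha ->
  exists (B : set H) (src rng : set_type B -> I) (S : set_type B -> H -> H),
    [/\ orthonormal_set B, (forall e, BH (S e)),
      (forall e f x y, inner (S e x) (S f y) =
        if e == f then inner (P (src e) x) y else 0),
      (forall e x, P (rng e) (S e x) = S e x)
    & forall w, W w -> forall x,
        has_sum (fun e => (S e \o w \o adj (S e)) x) (alpha w x)].
Proof.
move=> W P_proj P_orth /choice[xi xiE] one_proj one_sum P_one one_P alpha_end alpha_normal.
have xi_norm i := (xiE i).1; have P_xi i := (xiE i).2.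
have [B [src [rng [B_on alpha_src P_rng B_max]]]] := edge_set_exists P alpha xi.
have [Q [Q_proj Q_sum S_Q]] := edge_range_projection P_proj P_orth one_proj one_sum
  one_P alpha_end P_xi B_on alpha_src.
exists B, src, rng, (edge_op P alpha xi src); split=> //.
- exact: (edge_op_BH P_proj P_orth one_proj one_sum one_P alpha_end P_xi B_on alpha_src).
- exact: (edge_op_ip P_proj P_orth one_proj one_sum one_P alpha_end P_xi B_on alpha_src).
- exact: (edge_op_rng P_proj P_orth one_proj one_sum one_P alpha_end P_xi src P_rng).
- move=> w Ww x.
  exact: (alpha_decomposition P_proj P_orth one_proj one_sum P_one one_P alpha_end
    alpha_normal xi_norm P_xi B_on alpha_src P_rng B_max Q_proj Q_sum S_Q Ww).
Qed.

Theorem theorem4p1 (R : realType) (H : hilbertType R) (I : countType)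
    (W_ : I -> set (H -> H)) (P : I -> H -> H) (W : set (H -> H))
    (alpha : (H -> H) -> H -> H) :
  (forall i, type_I_factor (W_ i)) ->
  (forall i, projection (P i)) ->
  (forall i j, i != j -> P i \o P j = 0) ->
  (forall i, W_ i = corner (P i)) ->
  W = vn_direct_sum W_ ->
  star_endomorphism W alpha ->
  normal_map W alpha ->
  exists E : graph,
    [/\ countable [set: vert E],
        separable H -> countable [set: edge E]
      & forall (T : cstarType R) (sigma_u : (edge E -> R[i]) -> T)
          (pi_u : (vert E -> R[i]) -> T),
        is_toeplitz_algebra sigma_u pi_u ->
        exists2 tau : T -> H -> H, star_representation tau
        & forall w, W w -> forall x : H,
          has_sum (fun e => (tau (sigma_u (delta_edge R e)) \o w \o
                             adj (tau (sigma_u (delta_edge R e)))) x)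
                  (alpha w x)].
Proof.
move=> typeI P_proj P_orth WE -> alpha_end alpha_normal.
have {}WE : W_ = fun i => corner (P i) by exact/funext.
subst W_.
have P_unit i := corner_unit_vector (P_proj i) (typeI i).
have [one [one_proj one_sum P_one one_P]] := corners_unit P_proj P_orth.
have [B [src [rng [S [B_on S_BH S_ip S_rng S_sum]]]]] :=
  intertwining_isometries P_proj P_orth P_unit one_proj one_sum P_one one_P
    alpha_end alpha_normal.
(* Vertices are the indices of the summands and edges are the vectors of [B]. *)
exists (Graph rng src); split=> [|sepH|T sigma_u pi_u [_ univ]].
- exact: countableP.
- exact: orthonormal_countable.
have rep := @toeplitz_family_rep _ _ (Graph rng src) P S one P_proj P_orth P_unit
  one_proj one_sum P_one S_BH S_ip S_rng.
have [rho [[[rho_lin rhoM rho_star] rho_sigma _] _]] := univ _ _ _ rep.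
(* The homomorphism [rho] given by universality sends each edge generator to [S e], which turns the
   decomposition of [alpha] into the required sum. *)
have tauS e : rho (sigma_u (delta_edge R e)) = S e :> (H -> H).
  rewrite -rho_sigma; last exact: XE_delta_edge.
  by apply/funext => h; exact: sigma_delta_edge.
exists (fun t => rho t : H -> H).
  split=> [t|k s t|s t|t]; first exact: bop_BH.
  - by rewrite rho_lin.
  - by rewrite rhoM.
  - by rewrite rho_star.
by move=> w Ww x; apply: eq_has_sum (S_sum w Ww x) => e; rewrite !tauS.
Qed.
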